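(* The theory $\mathsf{ATR}_0$ proves both $\mathsf{HL}_{\bm{\Sigma}^0_1}$ and $\mathsf{HL}_{\bm{\Pi}^0_1}$. That is, $\mathsf{ATR}_0$ proves both of the following statements: (1) for every code $A \subseteq \mathbb{N}^{<\mathbb{N}}$ for an open set, there is either a Hechler tree $T$ such that every $f\in[T]$ belongs to the open set coded by $A$, or a Laver tree $S$ such that no $f \in [S]$ belongs to it; (2) for every code $A\subseteq \mathbb{N}^{<\mathbb{N}}$ for an open set, there is either a Hechler tree $T$ such that no $f\in[T]$ belongs to the open set coded by $A$, or a Laver tree $S$ such that every $f\in[S]$ belongs to it.
   Context: We work in the language of second order arithmetic; $\mathbb{N}$ is the first order part. $\mathsf{ATR}_0$ is $\mathsf{RCA}_0$ plus the schema of arithmetical transfinite recursion. A tree is a prefix-closed subset of $\mathbb{N}^{<\mathbb{N}}$, and its body is $[T]=\{f\in\mathbb{N}^{\mathbb{N}} : \forall n\ f\upharpoonright n\in T\}$. A Laver tree (always with empty stem) is a tree $T$ with $\langle\rangle \in T$ such that every $\sigma\in T$ has infinitely many immediate successors $\sigma^{\frown} n$ in $T$. A Hechler tree is a Laver tree $T$ such that for every $\rho\in T$, $\rho^{\frown} n\in T$ for all but finitely many $n$. A set $A\subseteq\mathbb{N}^{<\mathbb{N}}$ codes the open set $\{f : \exists \tau\prec f\ (\tau\in A)\}$. *)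

(* Defs.v *)
From Stdlib Require Import List.
Import ListNotations.

(** Two-sorted first-order language with classical logic.  Variables are de
    Bruijn indices, with one index space for each sort: [∀¹], [∃¹] bind number
    variable 0 and leave the set indices alone, [∀²], [∃²] bind set variable 0
    and leave the number indices alone.  Set variables are the only terms of
    the set sort. *)

Inductive term : Type :=
| Var (n : nat)
| Zero
| One
| Plus (s t : term)
| Times (s t : term).

Inductive form : Type :=
| Eq (s t : term)
| Lt (s t : term)
| Mem (t : term) (X : nat)
| Bot
| Imp (p q : form)
| AllNum (p : form)
| AllSet (p : form).

Definition Not p := Imp p Bot.
Definition And p q := Not (Imp p (Not q)).
Definition Or p q := Imp (Not p) q.
Definition Iff p q := And (Imp p q) (Imp q p).
Definition ExN p := Not (AllNum (Not p)).
Definition ExS p := Not (AllSet (Not p)).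

Declare Scope so_scope.
Delimit Scope so_scope with so.
Bind Scope so_scope with term.
Bind Scope so_scope with form.

Notation "# n" := (Var n) (at level 1, n at level 0, format "# n") : so_scope.
Notation "0" := Zero : so_scope.
Notation "1" := One : so_scope.
Infix "+" := Plus : so_scope.
Infix "*" := Times : so_scope.
Infix "≐" := Eq (at level 70) : so_scope.
Infix "≺" := Lt (at level 70) : so_scope.
Notation "t ∈ X" := (Mem t X%nat) (at level 70) : so_scope.
Notation "⊥" := Bot : so_scope.
Notation "¬ p" := (Not p) (at level 75, right associativity) : so_scope.
Infix "∧" := And (at level 80, right associativity) : so_scope.
Infix "∨" := Or (at level 85, right associativity) : so_scope.
Infix "⇒" := Imp (at level 90, right associativity) : so_scope.
Infix "⇔" := Iff (at level 95, no associativity) : so_scope.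
Notation "∀¹ p" := (AllNum p) (at level 10, p at level 200) : so_scope.
Notation "∃¹ p" := (ExN p) (at level 10, p at level 200) : so_scope.
Notation "∀² p" := (AllSet p) (at level 10, p at level 200) : so_scope.
Notation "∃² p" := (ExS p) (at level 10, p at level 200) : so_scope.

Local Open Scope so_scope.

(** Simultaneous capture-avoiding substitution: [f] acts on the number
    variables, [g] renames the set variables. *)

Fixpoint tsubst (f : nat -> term) (t : term) : term :=
  match t with
  | Var n => f n
  | Zero => Zero
  | One => One
  | Plus s t => Plus (tsubst f s) (tsubst f t)
  | Times s t => Times (tsubst f s) (tsubst f t)
  end.

Definition lift (k : nat) (t : term) : term := tsubst (fun n => Var (k + n)) t.

Notation "t ↑ k" := (lift k t) (at level 2, k at level 0, format "t ↑ k")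
  : so_scope.

Definition scons {A : Type} (a : A) (f : nat -> A) (n : nat) : A :=
  match n with O => a | S n => f n end.

Definition upN (f : nat -> term) : nat -> term :=
  scons (Var 0) (fun n => lift 1 (f n)).
Definition upS (g : nat -> nat) : nat -> nat := scons O (fun n => S (g n)).

Fixpoint subst (f : nat -> term) (g : nat -> nat) (p : form) : form :=
  match p with
  | Eq s t => Eq (tsubst f s) (tsubst f t)
  | Lt s t => Lt (tsubst f s) (tsubst f t)
  | Mem t X => Mem (tsubst f t) (g X)
  | Bot => Bot
  | Imp p q => Imp (subst f g p) (subst f g q)
  | AllNum p => AllNum (subst (upN f) g p)
  | AllSet p => AllSet (subst f (upS g) p)
  end.

Definition renum (f : nat -> term) : form -> form := subst f (fun X => X).
Definition reset (g : nat -> nat) : form -> form := subst Var g.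

Definition shiftN : form -> form := renum (fun n => Var (S n)).
Definition shiftS : form -> form := reset S.
Definition instN (p : form) (t : term) : form := renum (scons t Var) p.
Definition instS (p : form) (X : nat) : form := reset (scons X (fun Y => Y)) p.

(** The axioms in [T] stand for their universal closures: [prv_ax] may be used
    below [prv_allNI] and [prv_allSI], so the free variables of an axiom can be
    generalised, unlike those of a hypothesis in [G]. *)

Inductive prv (T : form -> Prop) : list form -> form -> Prop :=
| prv_ax G p : T p -> prv T G p
| prv_hyp G p : In p G -> prv T G p
| prv_impI G p q : prv T (p :: G) q -> prv T G (p ⇒ q)
| prv_impE G p q : prv T G (p ⇒ q) -> prv T G p -> prv T G q
| prv_raa G p : prv T ((¬ p) :: G) ⊥ -> prv T G p
| prv_allNI G p : prv T (map shiftN G) p -> prv T G (∀¹ p)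
| prv_allNE G p t : prv T G (∀¹ p) -> prv T G (instN p t)
| prv_allSI G p : prv T (map shiftS G) p -> prv T G (∀² p)
| prv_allSE G p X : prv T G (∀² p) -> prv T G (instS p X)
| prv_refl G t : prv T G (t ≐ t)
| prv_leib G p s t : prv T G (s ≐ t) -> prv T G (instN p s) -> prv T G (instN p t).

Definition proves (T : form -> Prop) (p : form) : Prop := prv T [] p.

Inductive Sigma00 : form -> Prop :=
| S00_eq s t : Sigma00 (s ≐ t)
| S00_lt s t : Sigma00 (s ≺ t)
| S00_mem t X : Sigma00 (t ∈ X)
| S00_bot : Sigma00 ⊥
| S00_imp p q : Sigma00 p -> Sigma00 q -> Sigma00 (p ⇒ q)
| S00_ball t p : Sigma00 p -> Sigma00 (∀¹ (#0 ≺ t↑1 ⇒ p))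
| S00_bex t p : Sigma00 p -> Sigma00 (∃¹ (#0 ≺ t↑1 ∧ p)).

Inductive Sigma01 : form -> Prop :=
| S01_intro p : Sigma00 p -> Sigma01 (∃¹ p).

Inductive Pi01 : form -> Prop :=
| P01_intro p : Sigma00 p -> Pi01 (∀¹ p).

Fixpoint arithmetical (p : form) : Prop :=
  match p with
  | Imp p q => arithmetical p /\ arithmetical q
  | AllNum p => arithmetical p
  | AllSet _ => False
  | _ => True
  end.

Inductive basic_axiom : form -> Prop :=
| B_succ_neq0 : basic_axiom (¬ (#0 + 1 ≐ 0))
| B_succ_inj : basic_axiom (#0 + 1 ≐ #1 + 1 ⇒ #0 ≐ #1)
| B_plus0 : basic_axiom (#0 + 0 ≐ #0)
| B_plusS : basic_axiom (#0 + (#1 + 1) ≐ (#0 + #1) + 1)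
| B_times0 : basic_axiom (#0 * 0 ≐ 0)
| B_timesS : basic_axiom (#0 * (#1 + 1) ≐ #0 * #1 + #0)
| B_lt0 : basic_axiom (¬ (#0 ≺ 0))
| B_ltS : basic_axiom (#0 ≺ #1 + 1 ⇔ (#0 ≺ #1 ∨ #0 ≐ #1)).

(** Induction on number variable 0; the other variables are parameters. *)
Definition induction (p : form) : form :=
  instN p 0
  ∧ (∀¹ (p ⇒ renum (scons (#0 + 1) (fun n => #(S n))) p))
  ⇒ ∀¹ p.

Definition delta01_comprehension (p q : form) : form :=
  (∀¹ (p ⇔ q)) ⇒ ∃² ∀¹ (#0 ∈ 0 ⇔ shiftS p).

Inductive RCA0 : form -> Prop :=
| RCA0_arithmetic p : basic_axiom p -> RCA0 p
| RCA0_induction p : Sigma01 p -> RCA0 (induction p)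
| RCA0_comprehension p q : Sigma01 p -> Pi01 q -> RCA0 (delta01_comprehension p q).

(** Pairing [(s, t) = (s + t)² + s]. *)
Definition pair (s t : term) : term := (s + t) * (s + t) + s.

Notation "⟨ s , t ⟩" := (pair s t) (format "⟨ s ,  t ⟩") : so_scope.

(** A set [X] is read as the binary relation [i ≤_X j] iff [⟨i, j⟩ ∈ X]. *)
Definition rel_le (X : nat) (i j : term) : form := ⟨i, j⟩ ∈ X.
Definition rel_lt (X : nat) (i j : term) : form :=
  rel_le X i j ∧ ¬ rel_le X j i.
Definition field (X : nat) (i : term) : form := rel_le X i i.

Definition is_LO (X : nat) : form :=
  (∀¹ #0 ∈ X ⇒ ∃¹ ∃¹ #2 ≐ ⟨#1, #0⟩)
  ∧ (∀¹ ∀¹ rel_le X #1 #0 ⇒ field X #1 ∧ field X #0)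
  ∧ (∀¹ ∀¹ ∀¹ rel_le X #2 #1 ∧ rel_le X #1 #0 ⇒ rel_le X #2 #0)
  ∧ (∀¹ ∀¹ rel_le X #1 #0 ∧ rel_le X #0 #1 ⇒ #1 ≐ #0)
  ∧ (∀¹ ∀¹ field X #1 ∧ field X #0 ⇒ rel_le X #1 #0 ∨ rel_le X #0 #1).

(** [F] is (the graph of) a total function from numbers to numbers. *)
Definition is_fun (F : nat) : form :=
  (∀¹ #0 ∈ F ⇒ ∃¹ ∃¹ #2 ≐ ⟨#1, #0⟩)
  ∧ (∀¹ ∀¹ ∀¹ ⟨#2, #1⟩ ∈ F ∧ ⟨#2, #0⟩ ∈ F ⇒ #1 ≐ #0)
  ∧ (∀¹ ∃¹ ⟨#1, #0⟩ ∈ F).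

Definition is_WO (X : nat) : form :=
  is_LO X
  ∧ ¬ ∃² (is_fun 0
          ∧ ∀¹ ∃¹ ∃¹ ⟨#2, #1⟩ ∈ 0 ∧ ⟨#2 + 1, #0⟩ ∈ 0 ∧ rel_lt (S X) #0 #1).

(** [Z = Y^j = {⟨m, i⟩ : i <_X j, ⟨m, i⟩ ∈ Y}]. *)
Definition is_below (X Y : nat) (j : term) (Z : nat) : form :=
  ∀¹ (#0 ∈ Z ⇔
      ∃¹ ∃¹ #2 ≐ ⟨#1, #0⟩ ∧ rel_lt X #0 j↑3 ∧ #2 ∈ Y).

(** For a formula [θ(n, Y)] with [n] number variable 0, [Y] set variable 0 and
    all other variables parameters: for every well order [X] there is [Y] with
    [Y = {⟨n, j⟩ : j ∈ field X, θ(n, Y^j)}].  In the matrix the number variables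
    are [j], [n], [x] and the set variables [Z], [Y], [X], innermost first;
    [Z] is [Y^j]. *)
Definition transfinite_recursion (θ : form) : form :=
  ∀² (is_WO 0 ⇒
    ∃² ∀¹ (#0 ∈ 0 ⇔
      ∃¹ ∃¹ #2 ≐ ⟨#1, #0⟩ ∧ field 1 #0
            ∧ ∃² (is_below 2 1 #0 0
                  ∧ subst (scons #1 (fun k => #(3 + k)))
                          (scons O (fun k => (3 + k)%nat)) θ))).

Inductive ATR0 : form -> Prop :=
| ATR0_RCA0 p : RCA0 p -> ATR0 p
| ATR0_rec θ : arithmetical θ -> ATR0 (transfinite_recursion θ).

(** A number [⟨k, ⟨m, n⟩⟩] represents the finite set of all [i < k] such that
    [m(i+1)+1] divides [n]; the code of a finite set is its least
    representative.  A finite sequence is the finite set that is its graph. *)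

Definition is_triple (c : term) : form := ∃¹ ∃¹ ∃¹ c↑3 ≐ ⟨#2, ⟨#1, #0⟩⟩.

Definition fin_mem (i c : term) : form :=
  ∃¹ ∃¹ ∃¹ c↑3 ≐ ⟨#2, ⟨#1, #0⟩⟩ ∧ i↑3 ≺ #2
           ∧ ∃¹ #1 ≐ #0 * (#2 * (i↑4 + 1) + 1).

Definition is_fin_code (c : term) : form :=
  is_triple c
  ∧ ∀¹ #0 ≺ c↑1 ⇒ ¬ (is_triple #0 ∧ ∀¹ (fin_mem #0 #1 ⇔ fin_mem #0 c↑2)).

Definition has_length (s l : term) : form :=
  ∀¹ (#0 ≺ l↑1 ⇔ ∃¹ fin_mem ⟨#1, #0⟩ s↑2).

Definition is_seq (s : term) : form :=
  is_fin_code s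
  ∧ (∀¹ fin_mem #0 s↑1 ⇒ ∃¹ ∃¹ #2 ≐ ⟨#1, #0⟩)
  ∧ (∀¹ ∀¹ ∀¹ fin_mem ⟨#2, #1⟩ s↑3 ∧ fin_mem ⟨#2, #0⟩ s↑3 ⇒ #1 ≐ #0)
  ∧ (∃¹ has_length s↑1 #0).

Definition is_nil (s : term) : form := is_seq s ∧ ∀¹ ¬ fin_mem #0 s↑1.

(** Between sequences, inclusion of graphs is the initial segment relation. *)
Definition is_prefix (s t : term) : form :=
  is_seq s ∧ is_seq t ∧ ∀¹ fin_mem #0 s↑1 ⇒ fin_mem #0 t↑1.

(** [t = s⌢n] *)
Definition is_snoc (s n t : term) : form :=
  is_seq s ∧ is_seq t
  ∧ ∃¹ has_length s↑1 #0
       ∧ ∀¹ (fin_mem #0 t↑2 ⇔ (fin_mem #0 s↑2 ∨ #0 ≐ ⟨#1, n↑2⟩)).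

(** [s = F↾n] *)
Definition is_restr (F : nat) (n s : term) : form :=
  is_seq s ∧ has_length s n ∧ ∀¹ fin_mem #0 s↑1 ⇒ #0 ∈ F.

Definition seq_set (A : nat) : form := ∀¹ #0 ∈ A ⇒ is_seq #0.

Definition is_tree (T : nat) : form :=
  seq_set T ∧ ∀¹ ∀¹ #0 ∈ T ∧ is_prefix #1 #0 ⇒ #1 ∈ T.

Definition snoc_mem (s n : term) (T : nat) : form :=
  ∃¹ is_snoc s↑1 n↑1 #0 ∧ #0 ∈ T.

Definition is_Laver (T : nat) : form :=
  is_tree T
  ∧ (∃¹ is_nil #0 ∧ #0 ∈ T)
  ∧ (∀¹ #0 ∈ T ⇒ ∀¹ ∃¹ #1 ≺ #0 ∧ snoc_mem #2 #0 T).

Definition is_Hechler (T : nat) : form :=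
  is_Laver T
  ∧ (∀¹ #0 ∈ T ⇒ ∃¹ ∀¹ #1 ≺ #0 ⇒ snoc_mem #2 #0 T).

Definition in_body (F T : nat) : form :=
  is_fun F ∧ ∀¹ ∃¹ is_restr F #1 #0 ∧ #0 ∈ T.

Definition in_open (F A : nat) : form :=
  is_fun F ∧ ∃¹ ∃¹ is_restr F #1 #0 ∧ #0 ∈ A.

Definition HL_Sigma01 : form :=
  ∀² (seq_set 0 ⇒
      (∃² (is_Hechler 0 ∧ ∀² in_body 0 1 ⇒ in_open 0 2))
    ∨ (∃² (is_Laver 0 ∧ ∀² in_body 0 1 ⇒ ¬ in_open 0 2))).

Definition HL_Pi01 : form :=
  ∀² (seq_set 0 ⇒
      (∃² (is_Hechler 0 ∧ ∀² in_body 0 1 ⇒ ¬ in_open 0 2))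
    ∨ (∃² (is_Laver 0 ∧ ∀² in_body 0 1 ⇒ in_open 0 2))).

(* Main.v *)
(** The calculus is complete for two-sorted structures (Henkin), so we argue in
    an arbitrary model of ATR0.  Transfinite recursion along the order [{0}] gives
    arithmetical comprehension, hence finite sequences, primitive recursion, etc.

    Both dichotomies are determinacy statements for an open game on sequences, in
    which one player tries to enter the open set and the other tries to avoid it.
    Consider the tree [T] of finite approximations to a winning strategy of the
    avoider in the game with a clock that descends through the Kleene-Brouwer order
    [L] of [T] itself; the definition of [T] is a legitimate course-of-values
    recursion.

    If [L] is a well-order, ATR yields the ranking along [L] of the positions won
    by the enterer.  If the empty position is not ranked, the avoider's winning
    strategy on the clock [L] exists; it is a path through [T], and its initial
    segments descend in [L], which is absurd.  So it is ranked, and the enterer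
    wins by decreasing the rank.

    If [L] is not a well-order, a descending sequence in [L] yields a path through
    [T], i.e. a winning strategy of the avoider with clock [L]; letting the clock
    run through the descending sequence, the avoider wins without a clock. *)

(* One order serves both cases, so there is no ranking along all well-orders and no
   pseudo-hierarchy: because the clock runs through the order of the very tree whose paths are the
   strategies, a strategy refutes well-foundedness of its own clock, while a failure of
   well-foundedness produces both a strategy and a sequence to drive its clock. The self-reference
   is legitimate since a sequence code exceeds every index below its length, and an index is at
   least as large as the clock value coded in it. For strategies to be the paths of a tree, each
   rule must be checkable on finitely many answers. Having infinitely many, or all but finitely
   many, good moves is not of that kind. Hence the avoider answers a challenge [k] by a single
   number [v], and the rules only relate two answers at a time. The relation [C] between answers and
   moves is the only difference between the two dichotomies. *)
Require Import Defs.
From Stdlib Require Import List Arith Lia Ring Classical ClassicalEpsilon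
  FunctionalExtensionality PropExtensionality Cantor.
Import ListNotations.
Set Implicit Arguments.

(** * Completeness of the calculus *)

Ltac fext := let n := fresh "n" in apply functional_extensionality; intros n.

(** * Algebra of simultaneous substitutions *)

Lemma tsubst_tsubst f g t :
  tsubst f (tsubst g t) = tsubst (fun n => tsubst f (g n)) t.
Proof. induction t; simpl; congruence. Qed.

Lemma tsubst_Var t : tsubst Var t = t.
Proof. induction t; simpl; congruence. Qed.

Lemma lift_tsubst f k t : tsubst f (lift k t) = tsubst (fun n => f (k + n)) t.
Proof. unfold lift. now rewrite tsubst_tsubst. Qed.

Lemma upN_Var : upN Var = Var.
Proof. fext. destruct n; reflexivity. Qed.

Lemma upS_id : upS (fun X => X) = fun X => X.
Proof. fext. destruct n; reflexivity. Qed.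

Lemma upN_comp f g :
  (fun n => tsubst (upN f) (upN g n)) = upN (fun n => tsubst f (g n)).
Proof.
  fext. destruct n as [|n]; [reflexivity|]. simpl. rewrite lift_tsubst.
  unfold lift. now rewrite tsubst_tsubst.
Qed.

Lemma upS_comp f g : (fun n => upS f (upS g n)) = upS (fun n => f (g n)).
Proof. fext. destruct n; reflexivity. Qed.

Lemma subst_subst p : forall f g f' g',
  subst f g (subst f' g' p)
  = subst (fun n => tsubst f (f' n)) (fun X => g (g' X)) p.
Proof.
  induction p; intros; simpl; rewrite ?tsubst_tsubst, ?IHp1, ?IHp2, ?IHp,
    ?upN_comp, ?upS_comp; reflexivity.
Qed.

Lemma subst_id p : subst Var (fun X => X) p = p.
Proof.
  induction p; simpl; rewrite ?tsubst_Var, ?upN_Var, ?upS_id; congruence.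
Qed.

Lemma subst_eq f g f' g' p :
  (forall n, f n = f' n) -> (forall n, g n = g' n) -> subst f g p = subst f' g' p.
Proof.
  intros H1 H2. f_equal; fext; auto.
Qed.

Ltac subst_tac :=
  unfold shiftN, shiftS, instN, instS, renum, reset;
  rewrite ?subst_subst; apply subst_eq;
  [ let n := fresh "n" in intros n; try (destruct n); simpl;
    rewrite ?lift_tsubst, ?tsubst_Var; try reflexivity
  | let n := fresh "n" in intros n; try (destruct n); reflexivity ].

Lemma subst_instN f g p t :
  subst f g (instN p t) = instN (subst (upN f) g p) (tsubst f t).
Proof.
  subst_tac.
Qed.

Lemma subst_instS f g p X :
  subst f g (instS p X) = instS (subst f (upS g) p) (g X).
Proof. subst_tac. Qed.

Lemma subst_shiftN f g p : subst (upN f) g (shiftN p) = shiftN (subst f g p).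
Proof. subst_tac. Qed.

Lemma subst_shiftS f g p : subst f (upS g) (shiftS p) = shiftS (subst f g p).
Proof. subst_tac. Qed.

(** * Bounds on free variables, the source of fresh variables *)

Fixpoint tbound (n : nat) (t : term) : Prop :=
  match t with
  | Var k => k < n
  | Zero | One => True
  | Plus s t | Times s t => tbound n s /\ tbound n t
  end.

Fixpoint bound (n m : nat) (p : form) : Prop :=
  match p with
  | Eq s t | Lt s t => tbound n s /\ tbound n t
  | Mem t X => tbound n t /\ X < m
  | Bot => True
  | Imp p q => bound n m p /\ bound n m q
  | AllNum p => bound (S n) m p
  | AllSet p => bound n (S m) p
  end.

Lemma tbound_mono n n' t : n <= n' -> tbound n t -> tbound n' t.
Proof. induction t; simpl; intuition lia. Qed.

Lemma bound_mono p : forall n n' m m',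
  n <= n' -> m <= m' -> bound n m p -> bound n' m' p.
Proof.
  induction p; simpl; intros n' n'' m' m'' Hn Hm Hp;
    repeat match goal with H : _ /\ _ |- _ => destruct H end;
    repeat split; eauto using tbound_mono; try lia.
  - eapply IHp; [..|exact Hp]; lia.
  - eapply IHp; [..|exact Hp]; lia.
Qed.

Lemma tbound_ex t : exists n, tbound n t.
Proof.
  induction t as [k| | |s [n Hn] t [m Hm]|s [n Hn] t [m Hm]];
    try (exists 0; exact I).
  - exists (S k). simpl. lia.
  - exists (n + m). split; eapply tbound_mono; try eassumption; lia.
  - exists (n + m). split; eapply tbound_mono; try eassumption; lia.
Qed.

Lemma bound_ex p : exists n, bound n n p.
Proof.
  induction p as [s t|s t|t X| |p [n Hn] q [m Hm]|p [n Hn]|p [n Hn]].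
  1, 2: destruct (tbound_ex s) as [n Hn], (tbound_ex t) as [m Hm];
    exists (n + m); split; eapply tbound_mono; try eassumption; lia.
  - destruct (tbound_ex t) as [n Hn]. exists (n + S X).
    split; [|lia]. eapply tbound_mono; try eassumption; lia.
  - exists 0. exact I.
  - exists (n + m). split; eapply bound_mono; try eassumption; lia.
  - exists n. simpl. eapply bound_mono; try eassumption; lia.
  - exists n. simpl. eapply bound_mono; try eassumption; lia.
Qed.

Lemma tsubst_bound n f f' t :
  tbound n t -> (forall k, k < n -> f k = f' k) -> tsubst f t = tsubst f' t.
Proof. induction t; simpl; intros; f_equal; intuition. Qed.

Lemma subst_bound p : forall n m f f' g g',
  bound n m p -> (forall k, k < n -> f k = f' k) ->
  (forall k, k < m -> g k = g' k) -> subst f g p = subst f' g' p.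
Proof.
  induction p; simpl; intros n' m' f f' g g' Hp Hf Hg;
    repeat match goal with H : _ /\ _ |- _ => destruct H end;
    f_equal; eauto using tsubst_bound.
  - eapply IHp; [exact Hp| |exact Hg]. intros [|k] Hk; [reflexivity|].
    simpl. rewrite Hf by lia. reflexivity.
  - eapply IHp; [exact Hp|exact Hf|]. intros [|k] Hk; [reflexivity|].
    simpl. rewrite Hg by lia. reflexivity.
Qed.

Section Completeness.
Context (T : form -> Prop).

Lemma prv_weaken G p : prv T G p -> forall G', incl G G' -> prv T G' p.
Proof.
  induction 1; intros G' HG.
  - now apply prv_ax.
  - apply prv_hyp. auto.
  - apply prv_impI, IHprv. intros r [->|Hr]; [now left|right; auto].
  - eapply prv_impE; eauto.
  - apply prv_raa, IHprv. intros r [->|Hr]; [now left|right; auto].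
  - apply prv_allNI, IHprv. now apply incl_map.
  - apply prv_allNE. auto.
  - apply prv_allSI, IHprv. now apply incl_map.
  - apply prv_allSE. auto.
  - apply prv_refl.
  - eapply prv_leib; eauto.
Qed.

(** Provability from every context is stable under the generalisation rules, which shift the
    context; this is how the universal closure of an axiom is reached. *)
Definition thm p := forall G, prv T G p.

Lemma thm_allN p : thm p -> thm (AllNum p).
Proof. intros H G. apply prv_allNI, H. Qed.

Lemma thm_allS p : thm p -> thm (AllSet p).
Proof. intros H G. apply prv_allSI, H. Qed.

(** Generalise variable 0, substitute for the remaining [n] variables below the new quantifier, then
    instantiate with [f 0]. *)
Lemma thm_subst_num n : forall p f,
  thm p -> (forall i, f (n + i) = Var i) -> thm (subst f (fun X => X) p).
Proof.
  induction n as [|n IH]; intros p f Hp Hf.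
  - replace f with Var by (fext; symmetry; apply Hf). now rewrite subst_id.
  - intros G. assert (H := IH (AllNum p) (fun k => f (S k)) (thm_allN Hp)).
    specialize (H (fun i => Hf i) G). simpl in H.
    apply prv_allNE with (t := f 0) in H.
    replace (subst f _ p) with
      (instN (subst (upN (fun k => f (S k))) (fun X => X) p) (f 0));
      [exact H|]. subst_tac.
Qed.

Lemma thm_subst_set n : forall p g,
  thm p -> (forall i, g (n + i) = i) -> thm (subst Var g p).
Proof.
  induction n as [|n IH]; intros p g Hp Hg.
  - replace g with (fun i : nat => i) by (fext; symmetry; apply Hg).
    now rewrite subst_id.
  - intros G. assert (H := IH (AllSet p) (fun k => g (S k)) (thm_allS Hp)).
    specialize (H (fun i => Hg i) G). simpl in H.
    apply prv_allSE with (X := g 0) in H.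
    replace (subst Var g p) with (instS (subst Var (upS (fun k => g (S k))) p) (g 0));
      [exact H|]. subst_tac.
Qed.

(** Only the finitely many free variables of [p] count, so [g] and then [f] may be altered beyond a
    bound to get the shape required above. Set and number variables are treated one after the
    other. *)
Lemma thm_subst p f g : thm p -> thm (subst f g p).
Proof.
  intros Hp. destruct (bound_ex p) as [n Hn].
  set (g' := fun k => if k <? n then g k else k - n).
  set (q := subst Var g' p).
  assert (Hq : thm q).
  { apply thm_subst_set with (n := n); [exact Hp|]. intros i. unfold g'.
    destruct (Nat.ltb_spec (n + i) n); lia. }
  destruct (bound_ex q) as [m Hm].
  set (f' := fun k => if k <? m then f k else Var (k - m)).
  assert (Hr : thm (subst f' (fun X => X) q)).
  { apply thm_subst_num with (n := m); [exact Hq|]. intros i. unfold f'.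
    destruct (Nat.ltb_spec (m + i) m); [lia|]. f_equal. lia. }
  assert (E : subst f (fun X => X) q = subst f' (fun X => X) q).
  { apply subst_bound with (n := m) (m := m); [exact Hm| |reflexivity].
    intros k Hk. unfold f'. now destruct (Nat.ltb_spec k m); [|lia]. }
  rewrite <- E in Hr. unfold q in Hr. rewrite subst_subst in Hr. simpl in Hr.
  replace (subst f g p) with (subst f g' p); [exact Hr|].
  apply subst_bound with (n := n) (m := n); [exact Hn|reflexivity|].
  intros k Hk. unfold g'. now destruct (Nat.ltb_spec k n); [|lia].
Qed.

Lemma prv_subst G p : prv T G p ->
  forall f g, prv T (map (subst f g) G) (subst f g p).
Proof.
  induction 1; intros f g.
  - apply thm_subst. intros G'. now apply prv_ax.
  - apply prv_hyp. now apply in_map.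
  - apply prv_impI, IHprv.
  - eapply prv_impE; [apply IHprv1|apply IHprv2].
  - apply prv_raa, IHprv.
  - simpl. apply prv_allNI. specialize (IHprv (upN f) g).
    rewrite map_map in *. erewrite map_ext; [exact IHprv|].
    intros q. symmetry. apply subst_shiftN.
  - rewrite subst_instN. apply prv_allNE, IHprv.
  - simpl. apply prv_allSI. specialize (IHprv f (upS g)).
    rewrite map_map in *. erewrite map_ext; [exact IHprv|].
    intros q. symmetry. apply subst_shiftS.
  - rewrite subst_instS. apply prv_allSE, IHprv.
  - apply prv_refl.
  - rewrite subst_instN. eapply prv_leib; [apply IHprv1|].
    rewrite <- subst_instN. apply IHprv2.
Qed.

Lemma bound_list (G : list form) : exists n, forall p, In p G -> bound n n p.
Proof.
  induction G as [|q G [n Hn]].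
  - exists 0. intros p [].
  - destruct (bound_ex q) as [m Hm]. exists (n + m).
    intros p [->|Hp]; eapply bound_mono; [| |exact Hm| | |apply Hn, Hp]; lia.
Qed.

(** The renaming that sends [x] to 0 and every other [k] to [S k] acts on [G] like [shiftN] and
    turns the instance at [x] back into [p]. *)
Lemma prv_fresh_num G p x :
  (forall q, In q G -> bound x x q) -> bound (S x) x p ->
  prv T G (instN p (Var x)) -> prv T G (AllNum p).
Proof.
  intros HG Hp H. apply prv_allNI.
  apply prv_subst with (f := fun k => if k =? x then Var 0 else Var (S k))
    (g := fun X => X) in H.
  replace (map shiftN G) with (map
    (subst (fun k => if k =? x then Var 0 else Var (S k)) (fun X => X)) G).
  - replace p with (subst (fun k => if k =? x then Var 0 else Var (S k))
      (fun X => X) (instN p (Var x))); [exact H|].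
    unfold instN, renum. rewrite subst_subst.
    rewrite <- (subst_id p) at 2. apply subst_bound with (n := S x) (m := x);
      [exact Hp| |reflexivity].
    intros [|k] Hk; simpl.
    + now rewrite Nat.eqb_refl.
    + destruct (Nat.eqb_spec k x); [lia|reflexivity].
  - apply map_ext_in. intros q Hq. apply subst_bound with (n := x) (m := x);
      [auto| |reflexivity].
    intros k Hk. destruct (Nat.eqb_spec k x); [lia|reflexivity].
Qed.

Lemma prv_fresh_set G p x :
  (forall q, In q G -> bound x x q) -> bound x (S x) p ->
  prv T G (instS p x) -> prv T G (AllSet p).
Proof.
  intros HG Hp H. apply prv_allSI.
  apply prv_subst with (f := Var) (g := fun k => if k =? x then 0 else S k) in H.
  replace (map shiftS G) with (map
    (subst Var (fun k => if k =? x then 0 else S k)) G).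
  - replace p with (subst Var (fun k => if k =? x then 0 else S k)
      (instS p x)); [exact H|].
    unfold instS, reset. rewrite subst_subst.
    rewrite <- (subst_id p) at 2. apply subst_bound with (n := x) (m := S x);
      [exact Hp|reflexivity|].
    intros [|k] Hk; simpl.
    + now rewrite Nat.eqb_refl.
    + destruct (Nat.eqb_spec k x); [lia|reflexivity].
  - apply map_ext_in. intros q Hq. apply subst_bound with (n := x) (m := x);
      [auto|reflexivity|].
    intros k Hk. destruct (Nat.eqb_spec k x); [lia|reflexivity].
Qed.

Definition consistent G := ~ prv T G Bot.

(** The Henkin condition is built in: a refuted universal formula comes with a refuted instance. *)
Definition decides G p :=
  prv T G p \/
  (prv T G (Not p) /\
   (forall q, p = AllNum q -> exists t, prv T G (Not (instN q t))) /\
   (forall q, p = AllSet q -> exists X, prv T G (Not (instS q X)))).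

Lemma henkin_step G p : consistent G ->
  exists G', incl G G' /\ consistent G' /\ decides G' p.
Proof.
  intros HG. destruct (classic (prv T (Not p :: G) Bot)) as [H|H].
  { apply prv_raa in H. exists G. split; [apply incl_refl|]. split; [exact HG|].
    now left. }
  destruct (bound_list (Not p :: G)) as [x Hx].
  assert (Hp : prv T (Not p :: G) (Not p)) by (apply prv_hyp; now left).
  destruct p as [ | | | | |q|q].
  1-5: eexists; split; [apply incl_tl, incl_refl|]; split; [exact H|];
    right; split; [exact Hp|]; split; discriminate.
  - exists (Not (instN q (Var x)) :: Not (AllNum q) :: G).
    split; [apply incl_tl, incl_tl, incl_refl|]. split; [|right; split; [|split]].
    (* If refuting the instance at the fresh [x] were inconsistent, that instance would be provable,
       hence also [AllNum q], against the consistency of its negation. *)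
    + intros H'. apply H. apply prv_raa in H'.
      eapply prv_impE; [exact Hp|]. eapply prv_fresh_num; [exact Hx| |exact H'].
      destruct (Hx (Not (AllNum q))) as [Hq _]; [now left|].
      eapply bound_mono; [| |exact Hq]; lia.
    + apply prv_hyp. right. now left.
    + intros q' E. injection E as <-. exists (Var x). apply prv_hyp. now left.
    + discriminate.
  - exists (Not (instS q x) :: Not (AllSet q) :: G).
    split; [apply incl_tl, incl_tl, incl_refl|]. split; [|right; split; [|split]].
    + intros H'. apply H. apply prv_raa in H'.
      eapply prv_impE; [exact Hp|]. eapply prv_fresh_set; [exact Hx| |exact H'].
      destruct (Hx (Not (AllSet q))) as [Hq _]; [now left|].
      eapply bound_mono; [| |exact Hq]; lia.
    + apply prv_hyp. right. now left.
    + discriminate.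
    + intros q' E. injection E as <-. exists x. apply prv_hyp. now left.
Qed.

End Completeness.

(** * Numbering of formulas *)

Definition npair (a b : nat) : nat := to_nat (a, b).

Lemma npair_inj a b c d : npair a b = npair c d -> a = c /\ b = d.
Proof. unfold npair. intros H. apply to_nat_inj in H. now injection H. Qed.

Opaque npair.

Fixpoint tcode (t : term) : nat :=
  match t with
  | Var n => npair 0 n
  | Zero => npair 1 0
  | One => npair 2 0
  | Plus s t => npair 3 (npair (tcode s) (tcode t))
  | Times s t => npair 4 (npair (tcode s) (tcode t))
  end.

Fixpoint code (p : form) : nat :=
  match p with
  | Eq s t => npair 0 (npair (tcode s) (tcode t))
  | Lt s t => npair 1 (npair (tcode s) (tcode t))
  | Mem t X => npair 2 (npair (tcode t) X)
  | Bot => npair 3 0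
  | Imp p q => npair 4 (npair (code p) (code q))
  | AllNum p => npair 5 (code p)
  | AllSet p => npair 6 (code p)
  end.

Ltac code_tac :=
  repeat match goal with
    H : npair _ _ = npair _ _ |- _ => apply npair_inj in H; destruct H
  end; try discriminate; try (f_equal; now auto).

Lemma tcode_inj s : forall t, tcode s = tcode t -> s = t.
Proof. induction s; intros [ ] H; simpl in H; code_tac. Qed.

Lemma code_inj p : forall q, code p = code q -> p = q.
Proof.
  induction p; intros [ ] H; simpl in H; code_tac; f_equal; auto using tcode_inj.
Qed.

Record structure := {
  dom : Type;
  sets : Type;
  zero : dom;
  one : dom;
  plus : dom -> dom -> dom;
  times : dom -> dom -> dom;
  less : dom -> dom -> Prop;
  elem : dom -> sets -> Prop
}.

Fixpoint teval (M : structure) (e : nat -> dom M) (t : term) : dom M :=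
  match t with
  | Var n => e n
  | Zero => zero M
  | One => one M
  | Plus s t => plus M (teval M e s) (teval M e t)
  | Times s t => times M (teval M e s) (teval M e t)
  end.

Fixpoint sat (M : structure) (e : nat -> dom M) (v : nat -> sets M) (p : form)
  : Prop :=
  match p with
  | Eq s t => teval M e s = teval M e t
  | Lt s t => less M (teval M e s) (teval M e t)
  | Mem t X => elem M (teval M e t) (v X)
  | Bot => False
  | Imp p q => sat M e v p -> sat M e v q
  | AllNum p => forall x, sat M (scons x e) v p
  | AllSet p => forall X, sat M e (scons X v) p
  end.

(** * The Henkin chain and the term model *)

Section Henkin.
Context (T : form -> Prop) (G0 : list form).
Context (G0_consistent : consistent T G0).

Definition cons_ctx := {G : list form | consistent T G}.

Lemma step_exists (n : nat) (G : cons_ctx) :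
  exists G' : cons_ctx, incl (proj1_sig G) (proj1_sig G') /\
    forall p, code p = n -> decides T (proj1_sig G') p.
Proof.
  destruct G as [G HG]. destruct (classic (exists p, code p = n)) as [[p Hp]|H].
  - destruct (henkin_step p HG) as [G' [H1 [H2 H3]]]. exists (exist _ G' H2).
    split; [exact H1|]. intros q Hq. rewrite <- Hp in Hq.
    apply code_inj in Hq. now subst q.
  - exists (exist _ G HG). split; [apply incl_refl|]. intros p Hp.
    destruct H. now exists p.
Qed.

(** Each stage is a finite list, so fresh variables never run out; stage [S n] decides the formula
    with code [n]. *)
Fixpoint chain (n : nat) : cons_ctx :=
  match n with
  | O => exist _ G0 G0_consistent
  | S n => proj1_sig (constructive_indefinite_description _
                        (step_exists n (chain n)))
  end.

Lemma chain_step n : incl (proj1_sig (chain n)) (proj1_sig (chain (S n))) /\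
  forall p, code p = n -> decides T (proj1_sig (chain (S n))) p.
Proof.
  simpl. now destruct (constructive_indefinite_description _ (step_exists n (chain n))).
Qed.

Lemma chain_mono m n : m <= n -> incl (proj1_sig (chain m)) (proj1_sig (chain n)).
Proof.
  induction 1 as [|n _ IH]; [apply incl_refl|].
  eapply incl_tran; [exact IH|apply chain_step].
Qed.

Definition holds p := exists n, prv T (proj1_sig (chain n)) p.

Lemma holds_prv p n : prv T (proj1_sig (chain n)) p ->
  forall m, n <= m -> prv T (proj1_sig (chain m)) p.
Proof. intros H m Hm. eapply prv_weaken; [exact H|now apply chain_mono]. Qed.

Lemma holds_bot : ~ holds Bot.
Proof. intros [n H]. exact (proj2_sig (chain n) H). Qed.

Lemma holds_mp p q : holds (Imp p q) -> holds p -> holds q.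
Proof.
  intros [n Hn] [m Hm]. exists (n + m).
  eapply prv_impE; eapply holds_prv; try eassumption; lia.
Qed.

Lemma holds_thm p : thm T p -> holds p.
Proof. intros H. exists 0. apply H. Qed.

Lemma holds_decides p : holds p \/
  (holds (Not p) /\
   (forall q, p = AllNum q -> exists t, holds (Not (instN q t))) /\
   (forall q, p = AllSet q -> exists X, holds (Not (instS q X)))).
Proof.
  destruct (proj2 (chain_step (code p)) p eq_refl) as [H|[H1 [H2 H3]]].
  - left. eexists. exact H.
  - right. split; [eexists; exact H1|]. split; intros q Hq.
    + destruct (H2 q Hq) as [t Ht]. exists t. eexists. exact Ht.
    + destruct (H3 q Hq) as [t Ht]. exists t. eexists. exact Ht.
Qed.

Lemma holds_imp p q : holds (Imp p q) <-> (holds p -> holds q).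
Proof.
  split; [apply holds_mp|]. intros H.
  destruct (holds_decides (Imp p q)) as [H'|[H' _]]; [exact H'|]. exfalso.
  apply holds_bot. apply (holds_mp H'). destruct (holds_decides p) as [Hp|[Hp _]].
  - destruct (H Hp) as [n Hn]. exists n. apply prv_impI.
    eapply prv_weaken; [exact Hn|apply incl_tl, incl_refl].
  - destruct Hp as [n Hn]. exists n. apply prv_impI, prv_raa. eapply prv_impE.
    + eapply prv_weaken; [exact Hn|apply incl_tl, incl_tl, incl_refl].
    + apply prv_hyp. right. now left.
Qed.

Lemma holds_allN p : holds (AllNum p) <-> forall t, holds (instN p t).
Proof.
  split.
  - intros [n Hn] t. exists n. now apply prv_allNE.
  - intros H. destruct (holds_decides (AllNum p)) as [H'|[_ [H' _]]]; [exact H'|].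
    destruct (H' p eq_refl) as [t Ht]. destruct (holds_bot (holds_mp Ht (H t))).
Qed.

Lemma holds_allS p : holds (AllSet p) <-> forall X, holds (instS p X).
Proof.
  split.
  - intros [n Hn] X. exists n. now apply prv_allSE.
  - intros H. destruct (holds_decides (AllSet p)) as [H'|[_ [_ H']]]; [exact H'|].
    destruct (H' p eq_refl) as [t Ht]. destruct (holds_bot (holds_mp Ht (H t))).
Qed.

Lemma holds_leib p s t : holds (Eq s t) -> holds (instN p s) -> holds (instN p t).
Proof.
  intros [n Hn] [m Hm]. exists (n + m).
  eapply prv_leib; eapply holds_prv; try eassumption; lia.
Qed.

Definition eqt s t := holds (Eq s t).

Lemma eqt_refl t : eqt t t.
Proof. exists 0. apply prv_refl. Qed.

Lemma inst_lift s t : tsubst (scons s Var) (lift 1 t) = t.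
Proof. rewrite lift_tsubst. apply tsubst_Var. Qed.

Ltac leib p H :=
  let L := fresh in
  assert (L := holds_leib p H); unfold instN, renum in L; simpl in L;
  rewrite ?inst_lift in L; apply L.

Lemma eqt_sym s t : eqt s t -> eqt t s.
Proof. intros H. leib (Eq (Var 0) (lift 1 s)) H. apply eqt_refl. Qed.

Lemma eqt_trans s t u : eqt s t -> eqt t u -> eqt s u.
Proof. intros H1 H2. leib (Eq (lift 1 s) (Var 0)) H2. exact H1. Qed.

Lemma eqt_plus s s' t t' : eqt s s' -> eqt t t' -> eqt (Plus s t) (Plus s' t').
Proof.
  intros H1 H2.
  leib (Eq (Plus (lift 1 s) (lift 1 t)) (Plus (Var 0) (lift 1 t'))) H1.
  leib (Eq (Plus (lift 1 s) (lift 1 t)) (Plus (lift 1 s) (Var 0))) H2.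
  apply eqt_refl.
Qed.

Lemma eqt_times s s' t t' : eqt s s' -> eqt t t' -> eqt (Times s t) (Times s' t').
Proof.
  intros H1 H2.
  leib (Eq (Times (lift 1 s) (lift 1 t)) (Times (Var 0) (lift 1 t'))) H1.
  leib (Eq (Times (lift 1 s) (lift 1 t)) (Times (lift 1 s) (Var 0))) H2.
  apply eqt_refl.
Qed.

Lemma holds_lt s s' t t' :
  eqt s s' -> eqt t t' -> holds (Lt s t) -> holds (Lt s' t').
Proof.
  intros H1 H2 H. leib (Lt (Var 0) (lift 1 t')) H1.
  leib (Lt (lift 1 s) (Var 0)) H2. exact H.
Qed.

Lemma holds_mem s s' X : eqt s s' -> holds (Mem s X) -> holds (Mem s' X).
Proof. intros H1 H. leib (Mem (Var 0) X) H1. exact H. Qed.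

Lemma eqt_class s t : eqt s t -> eqt s = eqt t.
Proof.
  intros H. fext. apply propositional_extensionality.
  split; intros H'; [apply eqt_trans with s|apply eqt_trans with t];
    auto using eqt_sym.
Qed.

(** Equivalent terms have the same class as a predicate ([eqt_class]), so [epsilon] picks the same
    representative for both: the terms fixed by [rep] replace a quotient type. *)
Definition rep (t : term) : term := epsilon (inhabits t) (eqt t).

Lemma rep_eqt t : eqt t (rep t).
Proof. unfold rep. apply epsilon_spec. exists t. apply eqt_refl. Qed.

Lemma rep_eq s t : rep s = rep t <-> eqt s t.
Proof.
  split; intros H.
  - eapply eqt_trans; [apply rep_eqt|]. rewrite H. apply eqt_sym, rep_eqt.
  - unfold rep. rewrite (eqt_class H). f_equal. apply proof_irrelevance.
Qed.

Definition carrier := {t : term | rep t = t}.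

Definition cls (t : term) : carrier :=
  exist _ (rep t) (proj2 (rep_eq (rep t) t) (eqt_sym (rep_eqt t))).

Lemma cls_eq s t : cls s = cls t <-> eqt s t.
Proof.
  rewrite <- rep_eq. unfold cls. split; intros H.
  - now injection H.
  - apply eq_exist_uncurried. exists H. apply proof_irrelevance.
Qed.

Lemma cls_proj (x : carrier) : cls (proj1_sig x) = x.
Proof. destruct x as [t Ht]. apply eq_exist_uncurried. exists Ht.
  apply proof_irrelevance. Qed.

Lemma proj_cls t : eqt (proj1_sig (cls t)) t.
Proof. apply eqt_sym, rep_eqt. Qed.

Definition term_model : structure := {|
  dom := carrier;
  sets := nat;
  zero := cls Zero;
  one := cls One;
  plus x y := cls (Plus (proj1_sig x) (proj1_sig y));
  times x y := cls (Times (proj1_sig x) (proj1_sig y));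
  less x y := holds (Lt (proj1_sig x) (proj1_sig y));
  elem x X := holds (Mem (proj1_sig x) X)
|}.

Lemma teval_term e t :
  teval term_model e t = cls (tsubst (fun n => proj1_sig (e n)) t).
Proof.
  induction t as [n| | |s IHs t IHt|s IHs t IHt]; simpl.
  - symmetry. apply cls_proj.
  - reflexivity.
  - reflexivity.
  - rewrite IHs, IHt. apply cls_eq, eqt_plus; apply proj_cls.
  - rewrite IHs, IHt. apply cls_eq, eqt_times; apply proj_cls.
Qed.

Lemma subst_scons_num t f g p :
  subst (scons t f) g p = instN (subst (upN f) g p) t.
Proof. subst_tac. Qed.

Lemma subst_scons_set X f g p :
  subst f (scons X g) p = instS (subst f (upS g) p) X.
Proof. subst_tac. Qed.

Lemma truth p : forall e v,
  sat term_model e v p <-> holds (subst (fun n => proj1_sig (e n)) v p).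
Proof.
  induction p as [s t|s t|t X| |p IHp q IHq|p IHp|p IHp]; intros e v; simpl.
  - rewrite !teval_term. apply cls_eq.
  - rewrite !teval_term. split; apply holds_lt; auto using eqt_sym, proj_cls.
  - rewrite !teval_term. split; apply holds_mem; auto using eqt_sym, proj_cls.
  - split; [tauto|apply holds_bot].
  - rewrite holds_imp, IHp, IHq. reflexivity.
  - rewrite holds_allN. split.
    + intros H t. specialize (H (cls t)). rewrite IHp in H.
      (* The quantifier of the model ranges over representatives only; Leibniz's law carries the
         instance at the representative of [t] over to [t]. *)
      apply holds_leib with (1 := proj_cls t). rewrite <- subst_scons_num.
      erewrite subst_eq; [exact H| |reflexivity]. intros [|n]; reflexivity.
    + intros H x. rewrite IHp. specialize (H (proj1_sig x)).
      rewrite <- subst_scons_num in H.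
      erewrite subst_eq; [exact H| |reflexivity]. intros [|n]; reflexivity.
  - rewrite holds_allS. split.
    + intros H X. specialize (H X). rewrite IHp in H.
      now rewrite <- subst_scons_set.
    + intros H X. rewrite IHp. specialize (H X).
      now rewrite <- subst_scons_set in H.
Qed.

End Henkin.

Definition models (M : structure) (T : form -> Prop) :=
  forall p, T p -> forall e v, sat M e v p.

(** The first hypothesis says that [p] is a sentence. With it [truth], which substitutes the
    environment, speaks about [p] itself: an unprovable [p] fails in the term model of a context
    containing [Not p]. *)
Theorem completeness T p :
  (forall f g, subst f g p = p) ->
  (forall M, models M T -> forall e v, sat M e v p) -> proves T p.
Proof.
  intros Hc HM. apply prv_raa. apply NNPP. intros Hcons.
  assert (Hp : holds Hcons (Not p)).
  { exists 0. apply prv_hyp. now left. }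
  assert (H : sat (term_model Hcons) (fun _ => cls Hcons Zero) (fun _ => 0) p).
  { apply HM. intros q Hq e v. apply truth, holds_thm, thm_subst.
    intros G. now apply prv_ax. }
  apply truth in H. rewrite Hc in H.
  exact (holds_bot (holds_mp Hp H)).
Qed.

(** * Semantics *)

Lemma teval_tsubst M e f t :
  teval M e (tsubst f t) = teval M (fun n => teval M e (f n)) t.
Proof. induction t; simpl; congruence. Qed.

Lemma sat_ext M p e e' v v' :
  (forall n, e n = e' n) -> (forall n, v n = v' n) -> sat M e v p -> sat M e' v' p.
Proof.
  intros H1 H2 H. replace e' with e by (fext; auto).
  now replace v' with v by (fext; auto).
Qed.

Lemma sat_subst M p : forall e v f g,
  sat M e v (subst f g p) <->
  sat M (fun n => teval M e (f n)) (fun n => v (g n)) p.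
Proof.
  induction p as [s t|s t|t X| |p IHp q IHq|p IHp|p IHp]; intros e v f g; simpl;
    rewrite ?teval_tsubst; try reflexivity.
  - rewrite IHp, IHq. reflexivity.
  - split; intros H x.
    + specialize (H x). apply IHp in H. eapply sat_ext; [| |exact H];
        intros [|n]; simpl; unfold lift; rewrite ?teval_tsubst; reflexivity.
    + apply IHp. eapply sat_ext; [| |exact (H x)];
        intros [|n]; simpl; unfold lift; rewrite ?teval_tsubst; reflexivity.
  - split; intros H X.
    + specialize (H X). apply IHp in H. eapply sat_ext; [| |exact H];
        intros [|n]; reflexivity.
    + apply IHp. eapply sat_ext; [| |exact (H X)]; intros [|n]; reflexivity.
Qed.

Lemma sat_imp M e v p q : sat M e v (Imp p q) <-> (sat M e v p -> sat M e v q).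
Proof. reflexivity. Qed.

Lemma sat_And M e v p q : sat M e v (And p q) <-> sat M e v p /\ sat M e v q.
Proof. simpl. tauto. Qed.

Lemma sat_Or M e v p q : sat M e v (Or p q) <-> sat M e v p \/ sat M e v q.
Proof. simpl. tauto. Qed.

Lemma sat_Iff M e v p q : sat M e v (Iff p q) <-> (sat M e v p <-> sat M e v q).
Proof. simpl. tauto. Qed.

Lemma sat_ExN M e v p : sat M e v (ExN p) <-> exists x, sat M (scons x e) v p.
Proof.
  simpl. split; [|firstorder]. intros H. apply NNPP. firstorder.
Qed.

Lemma sat_ExS M e v p : sat M e v (ExS p) <-> exists X, sat M e (scons X v) p.
Proof.
  simpl. split; [|firstorder]. intros H. apply NNPP. firstorder.
Qed.

Fixpoint size (p : form) : nat :=
  match p with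
  | Imp p q => S (size p + size q)
  | AllNum p | AllSet p => S (size p)
  | _ => 1
  end.

Section NiceSemantics.
Context (M : structure).

(** A premise [Not p] signals a disjunction, unless it encodes a conjunction or an existential
    quantifier; those are read as genuine premises. The recursive call is a parameter so that the
    case analysis can be verified apart from the recursion. *)
Definition nice_imp
  (rec : (nat -> dom M) -> (nat -> sets M) -> form -> Prop) e v (p q : form) : Prop :=
  match q with
  | Bot =>
    match p with
    | Imp p (Imp q Bot) => rec e v p /\ rec e v q
    | AllNum (Imp p Bot) => exists x, rec (scons x e) v p
    | AllSet (Imp p Bot) => exists X, rec e (scons X v) p
    | _ => ~ rec e v p
    end
  | _ =>
    match p with
    | Imp (Imp _ (Imp _ Bot)) Bot | Imp (AllNum (Imp _ Bot)) Bot
    | Imp (AllSet (Imp _ Bot)) Bot => rec e v p -> rec e v q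
    | Imp p Bot => rec e v p \/ rec e v q
    | _ => rec e v p -> rec e v q
    end
  end.

(** [sat], with the classical abbreviations of [Defs] read as the connectives of
    Rocq, so that the meaning of a concrete formula computes to a readable
    statement. *)
Fixpoint nsat (e : nat -> dom M) (v : nat -> sets M) (p : form) : Prop :=
  match p with
  | Eq s t => teval M e s = teval M e t
  | Lt s t => less M (teval M e s) (teval M e t)
  | Mem t X => elem M (teval M e t) (v X)
  | Bot => False
  | Imp p q => nice_imp nsat e v p q
  | AllNum p => forall x, nsat (scons x e) v p
  | AllSet p => forall X, nsat e (scons X v) p
  end.

Lemma nice_imp_spec rec e v p q :
  (forall e v r, size r < S (size p + size q) -> rec e v r <-> sat M e v r) ->
  nice_imp rec e v p q <-> sat M e v (Imp p q).
Proof.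
  intros IH. destruct (classic (q = Bot)) as [->|Hq].
  - assert (N : (~ rec e v p) <-> sat M e v (Not p)).
    { simpl. rewrite IH by lia. reflexivity. }
    destruct p as [| | | |p [| | | |p2 []| |]|[| | | |p []| |]|[| | | |p []| |]];
      try exact N; simpl in IH; cbn [nice_imp].
    + rewrite (sat_And M e v p p2), !IH by lia. reflexivity.
    + rewrite (sat_ExN M e v p).
      split; intros [x Hx]; exists x; apply IH; auto; lia.
    + rewrite (sat_ExS M e v p).
      split; intros [x Hx]; exists x; apply IH; auto; lia.
  - assert (N : (rec e v p -> rec e v q) <-> sat M e v (Imp p q)).
    { simpl. rewrite !IH by lia. reflexivity. }
    assert (O : forall p', p = Not p' ->
      (rec e v p' \/ rec e v q) <-> sat M e v (Imp p q)).
    { intros p' ->. simpl in IH. rewrite (sat_Or M e v p' q), !IH by lia.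
      reflexivity. }
    unfold nice_imp. destruct q; try congruence;
      destruct p as [| | | |p []|p|p]; try exact N;
      destruct p as [| | | |p [| | | |p2 []| |]|[| | | |p []| |]|[| | | |p []| |]];
      first [exact N|apply O; reflexivity].
Qed.

Lemma nsat_sat p e v : nsat e v p <-> sat M e v p.
Proof.
  remember (size p) as n eqn:E. assert (Hn : size p <= n) by lia. clear E.
  revert p e v Hn. induction n as [|n IH]; intros p e v Hn.
  { destruct p; simpl in Hn; lia. }
  destruct p as [| | | |p q|p|p]; simpl in Hn.
  1-4: reflexivity.
  - apply nice_imp_spec. intros e' v' r Hr. apply IH. lia.
  - split; intros H x; apply IH; auto; lia.
  - split; intros H x; apply IH; auto; lia.
Qed.

End NiceSemantics.

Lemma tsubst_lift f t : tsubst (upN f) (lift 1 t) = lift 1 (tsubst f t).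
Proof. rewrite lift_tsubst. unfold lift. now rewrite tsubst_tsubst. Qed.

Lemma Sigma00_subst p : Sigma00 p -> forall f g, Sigma00 (subst f g p).
Proof.
  induction 1; intros f g; simpl; try (now constructor).
  - rewrite tsubst_lift. now constructor.
  - rewrite tsubst_lift. now constructor.
Qed.

Lemma arithmetical_subst p : forall f g,
  arithmetical p -> arithmetical (subst f g p).
Proof. induction p; simpl; intuition. Qed.

Declare Scope dm_scope.
Delimit Scope dm_scope with dm.

Section Model.
Context (M : structure) (HM : models M ATR0) (v0 : nat -> sets M).

Notation D := (dom M).
Notation "0" := (zero M) : dm_scope.
Notation "1" := (one M) : dm_scope.
Infix "+" := (plus M) : dm_scope.
Infix "*" := (times M) : dm_scope.
Infix "<" := (less M) : dm_scope.
Infix "∈" := (elem M) (at level 70) : dm_scope.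
Local Open Scope dm_scope.

Local Notation env l := (fun n => nth n l 0).

(** * Arithmetic in a model *)

Lemma base p : basic_axiom p -> forall e, sat M e v0 p.
Proof. intros H e. apply HM, ATR0_RCA0, RCA0_arithmetic, H. Qed.

Lemma ind_form p : RCA0 (induction p) -> forall e v,
  sat M (scons 0 e) v p ->
  (forall x, sat M (scons x e) v p -> sat M (scons (x + 1) e) v p) ->
  forall x, sat M (scons x e) v p.
Proof.
  intros Hp e v H0 HS. assert (H := HM (ATR0_RCA0 _ Hp) e v).
  unfold induction in H. rewrite sat_imp, sat_And in H. apply H. clear H. split.
  - apply sat_subst. eapply sat_ext; [| |exact H0]; [|reflexivity].
    intros [|n]; reflexivity.
  - intros x Hx. apply sat_subst.
    eapply sat_ext; [| |exact (HS x Hx)]; [|reflexivity].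
    intros [|n]; reflexivity.
Qed.

Lemma s1_ind p : Sigma00 p -> forall e v,
  (exists z, sat M (scons z (scons 0 e)) v p) ->
  (forall x, (exists z, sat M (scons z (scons x e)) v p) ->
             exists z, sat M (scons z (scons (x + 1) e)) v p) ->
  forall x, exists z, sat M (scons z (scons x e)) v p.
Proof.
  intros Hp e v H0 HS x. rewrite <- sat_ExN. revert x.
  apply ind_form; [now apply RCA0_induction, S01_intro| |].
  - now apply sat_ExN.
  - intros x Hx. apply sat_ExN, HS. now apply sat_ExN.
Qed.

(** The induction axiom is stated for [Sigma01] formulas, so a dummy existential quantifier is put
    in front of the bounded formula. *)
Lemma s0_ind p : Sigma00 p -> forall e v,
  sat M (scons 0 e) v p ->
  (forall x, sat M (scons x e) v p -> sat M (scons (x + 1) e) v p) ->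
  forall x, sat M (scons x e) v p.
Proof.
  intros Hp e v H0 HS.
  assert (E : forall x z,
    sat M (scons z (scons x e)) v (shiftN p) <-> sat M (scons x e) v p).
  { intros x z. apply sat_subst. }
  assert (H := s1_ind (Sigma00_subst Hp (fun n => Var (S n)) (fun X => X)) e v).
  fold (renum (fun n => Var (S n)) p) in H. fold (shiftN p) in H.
  intros x. destruct H with (x := x) as [z Hz].
  - exists 0. now apply E.
  - intros y [z Hz]. exists 0. apply E, HS. now apply E in Hz.
  - now apply E in Hz.
Qed.

Ltac qf := repeat constructor.

Lemma succ_neq0 x : x + 1 <> 0.
Proof. exact (base B_succ_neq0 (env [x])). Qed.

Lemma succ_inj x y : x + 1 = y + 1 -> x = y.
Proof. exact (base B_succ_inj (env [x; y])). Qed.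

Lemma add0r x : x + 0 = x.
Proof. exact (base B_plus0 (env [x])). Qed.

Lemma addSr x y : x + (y + 1) = x + y + 1.
Proof. exact (base B_plusS (env [x; y])). Qed.

Lemma mul0r x : x * 0 = 0.
Proof. exact (base B_times0 (env [x])). Qed.

Lemma mulSr x y : x * (y + 1) = x * y + x.
Proof. exact (base B_timesS (env [x; y])). Qed.

Lemma lt0 x : ~ x < 0.
Proof. exact (base B_lt0 (env [x])). Qed.

Lemma ltS x y : x < y + 1 <-> x < y \/ x = y.
Proof.
  exact (proj2 (nsat_sat M _ _ _) (base B_ltS (env [x; y]))).
Qed.

Lemma add0l x : 0 + x = x.
Proof.
  revert x. apply (@s0_ind (Eq (Plus Zero #0) #0)) with (e := env []) (v := v0); simpl.
  - qf.
  - apply add0r.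
  - intros x IH. rewrite addSr, IH. reflexivity.
Qed.

Lemma addSl x y : y + 1 + x = y + x + 1.
Proof.
  revert x. apply (@s0_ind (Eq (Plus (Plus #1 One) #0) (Plus (Plus #1 #0) One)))
    with (e := env [y]) (v := v0); simpl.
  - qf.
  - now rewrite !add0r.
  - intros x IH. now rewrite !addSr, IH.
Qed.

Lemma addC x y : x + y = y + x.
Proof.
  revert x. apply (@s0_ind (Eq (Plus #0 #1) (Plus #1 #0)))
    with (e := env [y]) (v := v0); simpl.
  - qf.
  - now rewrite add0l, add0r.
  - intros x IH. now rewrite addSr, addSl, IH.
Qed.

Lemma addA x y z : x + (y + z) = x + y + z.
Proof.
  revert z. apply (@s0_ind (Eq (Plus #1 (Plus #2 #0)) (Plus (Plus #1 #2) #0)))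
    with (e := env [x; y]) (v := v0); simpl.
  - qf.
  - now rewrite !add0r.
  - intros z IH. now rewrite !addSr, IH.
Qed.

Lemma mul0l x : 0 * x = 0.
Proof.
  revert x. apply (@s0_ind (Eq (Times Zero #0) Zero))
    with (e := env []) (v := v0); simpl.
  - qf.
  - apply mul0r.
  - intros x IH. now rewrite mulSr, IH, add0r.
Qed.

Lemma mulSl x y : (y + 1) * x = y * x + x.
Proof.
  revert x. apply (@s0_ind (Eq (Times (Plus #1 One) #0) (Plus (Times #1 #0) #0)))
    with (e := env [y]) (v := v0); simpl.
  - qf.
  - now rewrite !mul0r, add0r.
  - intros x IH. rewrite !mulSr, IH, !addSr, <- !addA, (addA x), (addC x y).
    now rewrite <- addA.
Qed.

Lemma mulC x y : x * y = y * x.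
Proof.
  revert x. apply (@s0_ind (Eq (Times #0 #1) (Times #1 #0)))
    with (e := env [y]) (v := v0); simpl.
  - qf.
  - now rewrite mul0l, mul0r.
  - intros x IH. now rewrite mulSr, mulSl, IH.
Qed.

Lemma mulDr x y z : x * (y + z) = x * y + x * z.
Proof.
  revert z. apply (@s0_ind
    (Eq (Times #1 (Plus #2 #0)) (Plus (Times #1 #2) (Times #1 #0))))
    with (e := env [x; y]) (v := v0); simpl.
  - qf.
  - now rewrite mul0r, !add0r.
  - intros z IH. now rewrite addSr, !mulSr, IH, addA.
Qed.

Lemma mulA x y z : x * (y * z) = x * y * z.
Proof.
  revert z. apply (@s0_ind
    (Eq (Times #1 (Times #2 #0)) (Times (Times #1 #2) #0)))
    with (e := env [x; y]) (v := v0); simpl.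
  - qf.
  - now rewrite !mul0r.
  - intros z IH. now rewrite !mulSr, mulDr, IH.
Qed.

Lemma mul1l x : 1 * x = x.
Proof. rewrite <- (add0l 1), mulSl, mul0l. apply add0l. Qed.

Lemma semiring : semi_ring_theory 0 1 (plus M) (times M) (@eq D).
Proof.
  constructor; intros.
  - apply add0l.
  - apply addC.
  - apply addA.
  - apply mul1l.
  - apply mul0l.
  - apply mulC.
  - apply mulA.
  - rewrite !(mulC _ p), mulDr. reflexivity.
Qed.

Add Ring dm_ring : semiring.

Lemma addI x y z : x + z = y + z -> x = y.
Proof.
  revert z. apply (@s0_ind (Imp (Eq (Plus #1 #0) (Plus #2 #0)) (Eq #1 #2)))
    with (e := env [x; y]) (v := v0); simpl.
  - qf.
  - now rewrite !add0r.
  - intros z IH H. rewrite !addSr in H. apply IH. now apply succ_inj.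
Qed.

Lemma lt_succ x : x < x + 1.
Proof. apply ltS. now right. Qed.

Lemma lt_trans x y z : x < y -> y < z -> x < z.
Proof.
  intros H. revert z. apply (@s0_ind (Imp (Lt #2 #0) (Lt #1 #0)))
    with (e := env [x; y]) (v := v0); simpl.
  - qf.
  - intros H0. now apply lt0 in H0.
  - intros z IH H0. apply ltS. left. apply ltS in H0 as [H0| <-]; auto.
Qed.

Lemma lt_SS x y : x < y -> x + 1 < y + 1.
Proof.
  revert y. apply (@s0_ind (Imp (Lt #1 #0) (Lt (Plus #1 One) (Plus #0 One))))
    with (e := env [x]) (v := v0); simpl.
  - qf.
  - intros H. now apply lt0 in H.
  - intros y IH H. apply ltS. apply ltS in H as [H| <-]; auto.
Qed.

Lemma lt_irrefl x : ~ x < x.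
Proof.
  revert x. apply (@s0_ind (Imp (Lt #0 #0) Bot)) with (e := env []) (v := v0); simpl.
  - qf.
  - apply lt0.
  - intros x IH H. apply IH. apply ltS in H as [H|H].
    + eapply lt_trans; [apply lt_succ|exact H].
    + rewrite <- H at 2. apply lt_succ.
Qed.

Lemma lt_0S x : 0 < x + 1.
Proof.
  revert x. apply (@s0_ind (Lt Zero (Plus #0 One))) with (e := env []) (v := v0); simpl.
  - qf.
  - apply lt_succ.
  - intros x IH. apply ltS. now left.
Qed.

Lemma lt_ex x y : x < y <-> exists z, y = x + z + 1.
Proof.
  split.
  - intros H. revert H. revert y.
    assert (H : forall y, exists z, x < y -> y = x + z + 1).
    { apply (@s1_ind (Imp (Lt #2 #1) (Eq #1 (Plus (Plus #2 #0) One))))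
        with (e := env [x]) (v := v0); simpl.
      - qf.
      - exists 0. intros H. now apply lt0 in H.
      - intros y [z Hz]. destruct (classic (x < y)) as [H|H].
        + exists (z + 1). intros _. rewrite (Hz H) at 1. ring.
        + exists 0. intros H'. apply ltS in H' as [H'| ->]; [tauto|ring]. }
    intros y. destruct (H y) as [z Hz]. eauto.
  - intros [z ->]. revert z.
    apply (@s0_ind (Lt #1 (Plus (Plus #1 #0) One)))
      with (e := env [x]) (v := v0); simpl.
    + qf.
    + rewrite add0r. apply lt_succ.
    + intros z IH. apply ltS. left. now rewrite addSr.
Qed.

Lemma lt_total x y : x < y \/ x = y \/ y < x.
Proof.
  assert (H : forall x, (x < y -> False) -> (x = y -> False) -> y < x).
  { apply (@s0_ind (Imp (Imp (Lt #0 #1) Bot) (Imp (Imp (Eq #0 #1) Bot) (Lt #1 #0))))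
      with (e := env [y]) (v := v0); simpl.
    - qf.
    - intros H1 H2. exfalso. revert H2 H1. revert y.
      apply (@s0_ind (Imp (Imp (Eq Zero #0) Bot) (Imp (Imp (Lt Zero #0) Bot) Bot)))
        with (e := env []) (v := v0); simpl.
      + qf.
      + auto.
      + intros w _ _ H. apply H, lt_0S.
    - intros z IH H1 H2. apply ltS. destruct (classic (y = z)) as [E|E]; [tauto|].
      left. apply IH; [|congruence]. intros H. apply lt_SS in H.
      apply ltS in H as [H|H]; auto. }
  destruct (classic (x < y)); [tauto|]. destruct (classic (x = y)); [tauto|].
  right. right. now apply H.
Qed.

Lemma case0S x : x = 0 \/ exists y, x = y + 1.
Proof.
  destruct (lt_total 0 x) as [H|[H|H]].
  - right. apply lt_ex in H as [z ->]. exists z. ring.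
  - now left.
  - now apply lt0 in H.
Qed.

Lemma add_eq0 x y : x + y = 0 -> x = 0 /\ y = 0.
Proof.
  intros H. destruct (case0S x) as [->|[z ->]].
  - split; [reflexivity|]. now rewrite add0l in H.
  - exfalso. apply (@succ_neq0 (z + y)). rewrite <- H. ring.
Qed.

Lemma mul_eq0 x y : x * y = 0 -> x = 0 \/ y = 0.
Proof.
  intros H. destruct (case0S x) as [->|[z ->]]; [now left|right].
  apply add_eq0 with (z * y). rewrite <- H. ring.
Qed.

Definition pr (x y : D) : D := (x + y) * (x + y) + x.

Lemma pr_sum_not_lt a b a' b' : pr a b = pr a' b' -> ~ a + b < a' + b'.
Proof.
  unfold pr. intros H L. apply lt_ex in L as [z Hz]. rewrite Hz in H.
  (* This term plus one is the difference of the two codes, expanded after replacing [a' + b'] by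
     [a + b + z + 1]; one of the two summands [a] has been cancelled. *)
  apply (@succ_neq0 (a + a * z + a * z + b + b + b * z + b * z + z * z + z + z + a')).
  apply addI with ((a + b) * (a + b) + a). rewrite H at 2. ring.
Qed.

Lemma pr_inj a b a' b' : pr a b = pr a' b' -> a = a' /\ b = b'.
Proof.
  intros H. assert (E : a + b = a' + b').
  { destruct (lt_total (a + b) (a' + b')) as [L|[E|L]]; [|exact E|];
      apply pr_sum_not_lt in L; intuition congruence. }
  unfold pr in H. rewrite E, !(addC (_ * _)) in H. apply addI in H. subst a'.
  split; [reflexivity|]. rewrite !(addC a) in E. now apply addI in E.
Qed.

(** * Arithmetical comprehension and definability *)

Definition rle (X : sets M) (i j : D) : Prop := pr i j ∈ X.
Definition rlt (X : sets M) (i j : D) : Prop := rle X i j /\ ~ rle X j i.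

Definition isLO (X : sets M) : Prop :=
  (forall x, x ∈ X -> exists a b, x = pr a b)
  /\ (forall a b, rle X a b -> rle X a a /\ rle X b b)
  /\ (forall a b c, rle X a b /\ rle X b c -> rle X a c)
  /\ (forall a b, rle X a b /\ rle X b a -> a = b)
  /\ (forall a b, rle X a a /\ rle X b b -> rle X a b \/ rle X b a).

Definition isFun (F : sets M) : Prop :=
  (forall x, x ∈ F -> exists a b, x = pr a b)
  /\ (forall a b c, pr a b ∈ F /\ pr a c ∈ F -> b = c)
  /\ (forall a, exists b, pr a b ∈ F).

Definition isWO (X : sets M) : Prop :=
  isLO X
  /\ ~ exists F, isFun F
       /\ forall n, exists a b, pr n a ∈ F /\ pr (n + 1) b ∈ F /\ rlt X b a.

Lemma sat_WO e v : sat M e v (is_WO O) <-> isWO (v O).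
Proof. rewrite <- nsat_sat. reflexivity. Qed.

Definition isBelow (X Y : sets M) (j : D) (Z : sets M) : Prop :=
  forall x, x ∈ Z <-> exists m i, x = pr m i /\ rlt X i j /\ x ∈ Y.

Lemma transfinite_rec th : arithmetical th -> forall e v X, isWO X ->
  exists Y, forall x, x ∈ Y <-> exists n j, x = pr n j /\ rle X j j /\
    exists Z, isBelow X Y j Z /\ sat M (scons n e) (scons Z v) th.
Proof.
  intros Hth e v X HX. assert (H := HM (ATR0_rec _ Hth) e v).
  specialize (H X (proj2 (sat_WO e (scons X v)) HX)).
  apply sat_ExS in H as [Y HY]. exists Y. intros x. specialize (HY x).
  apply sat_Iff in HY. rewrite <- !nsat_sat in HY.
  rewrite HY. clear HY. split.
  - intros (n & j & E & Hj & Z & HZ & Hn). exists n, j.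
    split; [exact E|]. split; [exact Hj|]. exists Z. split; [exact HZ|].
    apply nsat_sat, sat_subst in Hn.
    eapply sat_ext; [| |exact Hn]; intros [|k]; reflexivity.
  - intros (n & j & E & Hj & Z & HZ & Hn). exists n, j.
    split; [exact E|]. split; [exact Hj|]. exists Z. split; [exact HZ|].
    apply nsat_sat, sat_subst.
    eapply sat_ext; [| |exact Hn]; intros [|k]; reflexivity.
Qed.

Lemma delta01 p q : Sigma00 p -> Sigma00 q -> forall e v,
  (forall x, (exists z, sat M (scons z (scons x e)) v p) <->
             (forall z, sat M (scons z (scons x e)) v q)) ->
  exists X, forall x, x ∈ X <-> exists z, sat M (scons z (scons x e)) v p.
Proof.
  intros Hp Hq e v H.
  assert (A := HM (ATR0_RCA0 _ (RCA0_comprehension _ _ (S01_intro _ Hp) (P01_intro _ Hq))) e v).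
  unfold delta01_comprehension in A. rewrite sat_imp, sat_ExS in A.
  destruct A as [X HX].
  - intros x. rewrite sat_Iff, sat_ExN. apply H.
  - exists X. intros x. specialize (HX x). apply sat_Iff in HX.
    unfold shiftS, reset in HX. rewrite sat_subst, sat_ExN in HX. exact HX.
Qed.

Lemma pr00 : pr 0 0 = 0.
Proof. unfold pr. ring. Qed.

Lemma pr_eq0 a b : pr a b = 0 -> a = 0 /\ b = 0.
Proof. intros H. apply pr_inj. now rewrite pr00. Qed.

Lemma single0 : exists X, forall x, x ∈ X <-> x = 0.
Proof.
  destruct (@delta01 (Eq #1 Zero) (Eq #1 Zero)) with (e := env []) (v := v0)
    as [X HX]; [qf|qf| |].
  - intros x. simpl. split; [now intros [_ ?]|intros H; exists 0; apply (H 0)].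
  - exists X. intros x. rewrite HX. simpl. split; [now intros [_ ?]|].
    intros ->. now exists 0.
Qed.

Lemma single0_WO X : (forall x, x ∈ X <-> x = 0) -> isWO X.
Proof.
  intros HX. unfold isWO, isLO, rlt, rle. split; [repeat split|].
  - intros x Hx. exists 0, 0. apply HX in Hx. now rewrite pr00.
  - apply HX in H. apply pr_eq0 in H as [-> ->]. apply HX, pr00.
  - apply HX in H. apply pr_eq0 in H as [-> ->]. apply HX, pr00.
  - intros a b c [H1 H2]. apply HX in H1, H2. apply pr_eq0 in H1 as [-> ->].
    now apply HX.
  - intros a b [H1 H2]. apply HX in H1. now apply pr_eq0 in H1 as [-> ->].
  - intros a b [H1 H2]. left. apply HX in H1, H2. apply pr_eq0 in H1 as [-> _].
    apply pr_eq0 in H2 as [-> _]. apply HX, pr00.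
  - intros [F [_ HF]]. destruct (HF 0) as (a & b & _ & _ & H1 & H2).
    apply H2. apply HX in H1. apply pr_eq0 in H1 as [-> ->]. apply HX, pr00.
Qed.

(** Along the order [{0}] the recursion has a single stage with empty history, so it collects the
    pairs [pr x 0] with [th] true at [x]; projecting them takes only [delta01]. The schema asks for
    the history as a set, so the empty set is produced first. *)
Lemma comp_form th : arithmetical th -> forall e v,
  exists X, forall x, x ∈ X <-> sat M (scons x e) v th.
Proof.
  intros Hth e v. destruct single0 as [X HX].
  destruct (@transfinite_rec (shiftS th)) with (X := X) (e := e) (v := v)
    as [Y HY]; [now apply arithmetical_subst|now apply single0_WO|].
  assert (HB : exists Z, isBelow X Y 0 Z).
  { destruct (@delta01 Bot Bot) with (e := env []) (v := v0) as [Z HZ]; [qf|qf| |].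
    - intros x. simpl. split; [now intros [_ ?]|]. intros H. destruct (H 0).
    - exists Z. intros x. rewrite HZ. simpl. split; [now intros [_ ?]|].
      intros (m & i & _ & [H1 H2] & _). exfalso. apply H2. unfold rle in *.
      apply HX in H1. apply pr_eq0 in H1 as [-> _]. apply HX, pr00. }
  destruct (@delta01 (Mem (pair #1 Zero) 0) (Mem (pair #1 Zero) 0))
    with (e := env []) (v := fun _ : nat => Y) as [W HW]; [qf|qf| |].
  - intros x. simpl. split; [now intros [_ ?]|intros H; exists 0; apply (H 0)].
  - exists W. intros x. rewrite HW. change ((exists _ : D, pr x 0 ∈ Y) <-> sat M (scons x e) v th).
    setoid_rewrite HY. unfold shiftS, reset. split.
    + intros (_ & n & j & E & _ & Z & _ & H). apply pr_inj in E as [-> _].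
      apply sat_subst in H. exact H.
    + intros H. exists 0, x, 0. split; [reflexivity|]. split; [apply HX, pr00|].
      destruct HB as [Z HZ]. exists Z. split; [exact HZ|]. now apply sat_subst.
Qed.

(** * Closure properties of arithmetical predicates and functions *)

Unset Strict Implicit.

(** [P e Y] is arithmetical in the number variables [e], the set variable [Y] and
    set parameters; [Y] serves only to instantiate transfinite recursion. *)
Definition ar (P : (nat -> D) -> sets M -> Prop) : Prop :=
  exists p v, arithmetical p /\ forall e Y, sat M e (scons Y v) p <-> P e Y.

Definition df (f : (nat -> D) -> sets M -> D) : Prop :=
  ar (fun e Y => e O = f (fun n => e (S n)) Y).

Lemma ar_ext P Q : (forall e Y, P e Y <-> Q e Y) -> ar P -> ar Q.
Proof.
  intros H (p & v & Hp & HP). exists p, v. split; [exact Hp|].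
  intros e Y. rewrite HP. apply H.
Qed.

Lemma ar_all P : ar (fun e Y => P (fun n => e (S n)) Y (e O)) ->
  ar (fun e Y => forall x, P e Y x).
Proof.
  intros (p & v & Hp & HP). exists (AllNum p), v. split; [exact Hp|].
  intros e Y. split; intros H x; apply (HP (scons x e) Y), H.
Qed.

(** The two parameter assignments are interleaved, that of [p] on even and that of [q] on odd
    positions, behind the common set variable [Y]. *)
Lemma ar_imp P Q : ar P -> ar Q -> ar (fun e Y => P e Y -> Q e Y).
Proof.
  intros (p & v & Hp & HP) (q & w & Hq & HQ).
  exists (Imp (subst Var (scons O (fun n => S (2 * n))) p)
              (subst Var (scons O (fun n => S (S (2 * n)))) q)),
    (fun n => if Nat.even n then v (Nat.div2 n) else w (Nat.div2 n)).
  split; [split; now apply arithmetical_subst|].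
  intros e Y. rewrite sat_imp, !sat_subst, <- HP, <- HQ.
  assert (E : forall (A B A' B' : Prop), (A <-> A') -> (B <-> B') ->
    ((A -> B) <-> (A' -> B'))) by tauto.
  apply E; split; apply sat_ext; try reflexivity; intros [|n]; try reflexivity.
  all: cbn [scons]; rewrite ?Nat.even_succ, ?Nat.odd_mul, ?Nat.even_mul,
    ?Nat.div2_double, ?Nat.div2_succ_double; reflexivity.
Qed.

(** The formula is chosen by the truth value of [A] in the metatheory, so propositions about fixed
    objects never have to be formalised. *)
Lemma ar_const (A : Prop) : ar (fun _ _ => A).
Proof.
  destruct (classic A) as [H|H].
  - exists (Imp Bot Bot), v0. split; [exact (conj I I)|]. simpl. tauto.
  - exists Bot, v0. split; [exact I|]. simpl. tauto.
Qed.

Lemma ar_not P : ar P -> ar (fun e Y => ~ P e Y).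
Proof. intros H. apply ar_imp; [exact H|apply ar_const]. Qed.

Lemma ar_and P Q : ar P -> ar Q -> ar (fun e Y => P e Y /\ Q e Y).
Proof.
  intros HP HQ. apply ar_ext with (P := fun e Y => ~ (P e Y -> ~ Q e Y)).
  - intros e Y. tauto.
  - auto using ar_not, ar_imp.
Qed.

Lemma ar_or P Q : ar P -> ar Q -> ar (fun e Y => P e Y \/ Q e Y).
Proof.
  intros HP HQ. apply ar_ext with (P := fun e Y => ~ P e Y -> Q e Y).
  - intros e Y. tauto.
  - auto using ar_not, ar_imp.
Qed.

Lemma ar_iff P Q : ar P -> ar Q -> ar (fun e Y => P e Y <-> Q e Y).
Proof. intros HP HQ. apply ar_and; now apply ar_imp. Qed.

Lemma ar_ex P : ar (fun e Y => P (fun n => e (S n)) Y (e O)) ->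
  ar (fun e Y => exists x, P e Y x).
Proof.
  intros H. apply ar_ext with (P := fun e Y => ~ forall x, ~ P e Y x).
  - intros e Y. split; [|firstorder]. intros H'. apply NNPP. firstorder.
  - apply ar_not, ar_all, ar_not, H.
Qed.

Lemma ar_renum (k : nat -> nat) P : ar P -> ar (fun e Y => P (fun n => e (k n)) Y).
Proof.
  intros (p & v & Hp & HP).
  exists (subst (fun n => Var (k n)) (fun X => X) p), v.
  split; [now apply arithmetical_subst|]. intros e Y.
  rewrite sat_subst, <- HP. reflexivity.
Qed.

Lemma ar_app P f : ar (fun e Y => P (fun n => e (S n)) Y (e O)) -> df f ->
  ar (fun e Y => P e Y (f e Y)).
Proof.
  intros HP Hf.
  apply ar_ext with (P := fun e Y => exists x, x = f e Y /\ P e Y x).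
  - intros e Y. split; [now intros [x [-> H]]|eauto].
  - apply ar_ex, ar_and; [exact Hf|exact HP].
Qed.

Lemma df_var n : df (fun e _ => e n).
Proof.
  exists (Eq (Var 0) (Var (S n))), v0. split; [exact I|]. reflexivity.
Qed.

(** The formulas behind [ar] carry set parameters only, so the element [a] enters through its
    singleton, a set by comprehension. *)
Lemma df_const a : df (fun _ _ => a).
Proof.
  destruct (@comp_form (Eq #0 #1) I (env [a]) v0) as [X HX].
  exists (Mem #0 1), (fun _ => X). split; [exact I|]. intros e Y. apply HX.
Qed.

Lemma df_plus f g : df f -> df g -> df (fun e Y => f e Y + g e Y).
Proof.
  intros Hf Hg. unfold df.
  apply ar_app with (P := fun e Y x => e O = x + g (fun n => e (S n)) Y);
    [|apply (ar_renum (scons O (fun n => S (S n))) Hf)].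
  apply ar_app with (P := fun e Y x => e (S O) = e O + x);
    [|apply (ar_renum (scons O (fun n => S (S (S n)))) Hg)].
  exists (Eq #2 (Plus #1 #0)), v0. split; [exact I|]. reflexivity.
Qed.

Lemma df_times f g : df f -> df g -> df (fun e Y => f e Y * g e Y).
Proof.
  intros Hf Hg. unfold df.
  apply ar_app with (P := fun e Y x => e O = x * g (fun n => e (S n)) Y);
    [|apply (ar_renum (scons O (fun n => S (S n))) Hf)].
  apply ar_app with (P := fun e Y x => e (S O) = e O * x);
    [|apply (ar_renum (scons O (fun n => S (S (S n)))) Hg)].
  exists (Eq #2 (Times #1 #0)), v0. split; [exact I|]. reflexivity.
Qed.

Lemma ar_eq f g : df f -> df g -> ar (fun e Y => f e Y = g e Y).
Proof.
  intros Hf Hg. apply ar_app with (P := fun e Y x => x = g e Y); assumption.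
Qed.

Lemma ar_lt f g : df f -> df g -> ar (fun e Y => f e Y < g e Y).
Proof.
  intros Hf Hg.
  apply ar_app with (P := fun e Y x => x < g e Y); [|exact Hf].
  apply ar_app with (P := fun e Y x => e O < x);
    [|apply (ar_renum (scons O (fun n => S (S n))) Hg)].
  exists (Lt #1 #0), v0. split; [exact I|]. reflexivity.
Qed.

Lemma ar_mem f X : df f -> ar (fun e Y => f e Y ∈ X).
Proof.
  intros Hf. apply ar_app with (P := fun e Y x => x ∈ X); [|exact Hf].
  exists (Mem #0 1), (fun _ => X). split; [exact I|]. reflexivity.
Qed.

Lemma ar_memY f : df f -> ar (fun e Y => f e Y ∈ Y).
Proof.
  intros Hf. apply ar_app with (P := fun e Y x => x ∈ Y); [|exact Hf].
  exists (Mem #0 0), v0. split; [exact I|]. reflexivity.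
Qed.

Lemma comp_env P : ar (fun e Y => P (fun n => e (S n)) Y (e O)) ->
  forall e Y, exists X, forall x, x ∈ X <-> P e Y x.
Proof.
  intros (p & v & Hp & HP) e Y.
  destruct (comp_form _ Hp e (scons Y v)) as [X HX]. exists X. intros x.
  rewrite HX, HP. reflexivity.
Qed.

Lemma comp P : ar (fun e _ => P (e O)) -> exists X, forall x, x ∈ X <-> P x.
Proof. intros H. apply (comp_env (P := fun _ _ => P) H (env []) (v0 O)). Qed.

Lemma set_ind X : 0 ∈ X -> (forall x, x ∈ X -> x + 1 ∈ X) -> forall x, x ∈ X.
Proof.
  apply (@s0_ind (Mem #0 O)) with (e := env []) (v := fun _ => X). qf.
Qed.

Lemma ind P : ar (fun e _ => P (e O)) -> P 0 -> (forall x, P x -> P (x + 1)) ->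
  forall x, P x.
Proof.
  intros H H0 HS. destruct (comp H) as [X HX].
  intros x. apply HX. revert x. apply set_ind.
  - now apply HX.
  - intros x Hx. apply HX, HS. now apply HX.
Qed.

Lemma df_shift f : df f -> df (fun e Y => f (fun n => e (S n)) Y).
Proof. intros H. apply (ar_renum (scons O (fun n => S (S n))) H). Qed.

Lemma ar_comp1 (P : D -> Prop) f :
  ar (fun e _ => P (e O)) -> df f -> ar (fun e Y => P (f e Y)).
Proof. intros HP Hf. now apply ar_app with (P := fun e Y x => P x). Qed.

Lemma ar_comp2 (P : D -> D -> Prop) f g :
  ar (fun e _ => P (e O) (e 1%nat)) -> df f -> df g ->
  ar (fun e Y => P (f e Y) (g e Y)).
Proof.
  intros HP Hf Hg. apply ar_app with (P := fun e Y x => P x (g e Y)); [|exact Hf].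
  apply ar_app with (P := fun e Y x => P (e O) x); [|now apply df_shift].
  apply (ar_renum (scons 1%nat (fun _ => O)) HP).
Qed.

Lemma ar_comp3 (P : D -> D -> D -> Prop) f g h :
  ar (fun e _ => P (e O) (e 1%nat) (e 2%nat)) -> df f -> df g -> df h ->
  ar (fun e Y => P (f e Y) (g e Y) (h e Y)).
Proof.
  intros HP Hf Hg Hh.
  apply ar_app with (P := fun e Y x => P x (g e Y) (h e Y)); [|exact Hf].
  apply ar_app with (P := fun e Y x => P (e O) x (h (fun n => e (S n)) Y));
    [|now apply df_shift].
  apply ar_app with (P := fun e Y x => P (e 1%nat) (e O) x);
    [|exact (df_shift (df_shift Hh))].
  apply (ar_renum (scons 2%nat (scons 1%nat (fun _ => O))) HP).
Qed.

Lemma df_comp1 (F : D -> D) f :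
  df (fun e _ => F (e O)) -> df f -> df (fun e Y => F (f e Y)).
Proof.
  intros HF Hf.
  apply (ar_comp2 (P := fun x y => x = F y)); [exact HF|apply df_var|].
  now apply df_shift.
Qed.

Lemma df_comp2 (F : D -> D -> D) f g :
  df (fun e _ => F (e O) (e 1%nat)) -> df f -> df g ->
  df (fun e Y => F (f e Y) (g e Y)).
Proof.
  intros HF Hf Hg.
  apply (ar_comp3 (P := fun x y z => x = F y z)); [exact HF|apply df_var|..];
    now apply df_shift.
Qed.

(** A hook, redefined whenever new symbols are shown to be arithmetical, so that [ars] keeps up with
    the vocabulary. *)
Ltac ar_user := fail.

Ltac ar_step0 :=
  cbv beta;
  lazymatch goal with
  | |- ar (fun _ _ => ?A) => apply (ar_const A)
  | |- ar (fun e Y => ~ @?P e Y) => apply (ar_not (P := P))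
  | |- ar (fun e Y => @?P e Y /\ @?Q e Y) => apply (ar_and (P := P) (Q := Q))
  | |- ar (fun e Y => @?P e Y \/ @?Q e Y) => apply (ar_or (P := P) (Q := Q))
  | |- ar (fun e Y => @?P e Y <-> @?Q e Y) => apply (ar_iff (P := P) (Q := Q))
  | |- ar (fun e Y => @?P e Y -> @?Q e Y) => apply (ar_imp (P := P) (Q := Q))
  | |- ar (fun e Y => exists x, @?P e Y x) => apply (ar_ex (P := P))
  | |- ar (fun e Y => forall x, @?P e Y x) => apply (ar_all (P := P))
  | |- ar (fun e Y => @?f e Y = @?g e Y) => apply (ar_eq (f := f) (g := g))
  | |- ar (fun e Y => @?f e Y < @?g e Y) => apply (ar_lt (f := f) (g := g))
  | |- ar (fun e Y => @?f e Y ∈ Y) => apply (ar_memY (f := f))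
  | |- ar (fun e Y => @?f e Y ∈ ?X) => apply (ar_mem (f := f) X)
  | |- df (fun e Y => e ?n) => apply (df_var n)
  | |- df (fun _ _ => ?a) => apply (df_const a)
  | |- df (fun e Y => @?f e Y + @?g e Y) => apply (df_plus (f := f) (g := g))
  | |- df (fun e Y => @?f e Y * @?g e Y) => apply (df_times (f := f) (g := g))
  | _ => first [assumption | ar_user]
  end.

Ltac ar_step :=
  first
  [ ar_step0
  | match goal with
    | H : ar (fun e _ => ?P (e O)) |- ar (fun e Y => ?P (@?f e Y)) =>
        apply (ar_comp1 (P := P) (f := f)); [exact H|]
    | H : df (fun e _ => ?F (e O)) |- df (fun e Y => ?F (@?f e Y)) =>
        apply (df_comp1 (F := F) (f := f)); [exact H|]
    | H : ar (fun e _ => ?P (e O) (e 1%nat)) |- ar (fun e Y => ?P (@?f e Y) (@?g e Y)) =>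
        apply (ar_comp2 (P := P) (f := f) (g := g)); [exact H| |]
    | H : df (fun e _ => ?F (e O) (e 1%nat)) |- df (fun e Y => ?F (@?f e Y) (@?g e Y)) =>
        apply (df_comp2 (F := F) (f := f) (g := g)); [exact H| |]
    end ].

Ltac ars := repeat ar_step.

Lemma df_pr f g : df f -> df g -> df (fun e Y => pr (f e Y) (g e Y)).
Proof. intros. unfold pr. ars. Qed.

Ltac ar_user ::= first [apply df_pr].

(** * Induction, least elements and minimisation *)

Lemma strong_ind P : ar (fun e _ => P (e O)) ->
  (forall x, (forall y, y < x -> P y) -> P x) -> forall x, P x.
Proof.
  intros HP H x. assert (A : forall n y, y < n -> P y).
  { apply (ind (P := fun n => forall y, y < n -> P y)).
    - ars.
    - intros y Hy. now apply lt0 in Hy.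
    - intros n IH y Hy. apply ltS in Hy as [Hy| ->]; auto. }
  apply (A (x + 1)), lt_succ.
Qed.

Lemma least P : ar (fun e _ => P (e O)) -> (exists x, P x) ->
  exists x, P x /\ forall y, y < x -> ~ P y.
Proof.
  intros HP [x Hx]. apply NNPP. intros H. revert x Hx.
  apply (strong_ind (P := fun x => ~ P x)); [ars|].
  intros x IH Hx. apply H. now exists x.
Qed.

Definition mu_graph (P : D -> Prop) (z : D) : Prop :=
  (P z /\ forall y, y < z -> ~ P y) \/ ((forall x, ~ P x) /\ z = 0).

(** The least element of [P]; [0] if [P] is empty, unspecified if [P] has no
    least element (which is impossible for arithmetical [P]). *)
Definition mu (P : D -> Prop) : D := epsilon (inhabits 0) (mu_graph P).

Lemma mu_graph_unique P x y : mu_graph P x -> mu_graph P y -> x = y.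
Proof.
  intros [[H1 H2]|[H1 H2]] [[H3 H4]|[H3 H4]]; try congruence.
  - destruct (lt_total x y) as [H|[H|H]]; [|exact H|].
    + now destruct (H4 x).
    + now destruct (H2 y).
  - now destruct (H3 x).
  - now destruct (H1 y).
Qed.

Lemma mu_ex P X : (forall x, x ∈ X <-> P x) -> mu_graph P (mu P).
Proof.
  intros HX. apply (epsilon_spec (inhabits 0) (mu_graph P)). destruct (classic (exists x, P x)) as [H|H].
  - destruct (least (P := fun x => x ∈ X)) as [x [H1 H2]].
    + ars.
    + destruct H as [x Hx]. exists x. now apply HX.
    + exists x. left. split; [now apply HX|]. intros y Hy Py.
      apply (H2 y Hy). now apply HX.
  - exists 0. right. split; [|reflexivity]. intros x Hx. eauto.
Qed.

Lemma mu_spec P : ar (fun e _ => P (e O)) -> (exists x, P x) -> P (mu P).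
Proof.
  intros HP [x Hx]. destruct (comp HP) as [X HX].
  destruct (mu_ex HX) as [[H _]|[H _]]; [exact H|]. now destruct (H x).
Qed.

(** [mu] is a choice made outside the model; its graph is arithmetical because [mu_graph] has
    exactly one solution once comprehension has turned the predicate into a set. *)
Lemma df_mu P : ar (fun e Y => P (fun n => e (S n)) Y (e O)) ->
  df (fun e Y => mu (P e Y)).
Proof.
  intros HP. apply ar_ext with
    (P := fun e Y => mu_graph (P (fun n => e (S n)) Y) (e O)).
  - intros e Y. destruct (comp_env HP (fun n => e (S n)) Y) as [X HX].
    assert (H := mu_ex HX). split.
    + intros H'. exact (mu_graph_unique H' H).
    + intros ->. exact H.
  - unfold mu_graph.
    ars; apply (ar_renum (scons 0%nat (fun n => S (S n))) HP).
Qed.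

(** * Coding of finite sets and sequences *)

Definition dv (a b : D) : Prop := exists q, b = q * a.

Lemma dv_mul a b c : dv a b -> dv a (b * c).
Proof. intros [q ->]. exists (q * c). ring. Qed.

Lemma dv_sub q a b : dv q a -> dv q (a + b) -> dv q b.
Proof.
  intros [k ->] [l Hl]. destruct (lt_total k l) as [H|[->|H]].
  - apply lt_ex in H as [z ->]. exists (z + 1). apply addI with (k * q).
    rewrite addC, Hl. ring.
  - exists 0. apply addI with (l * q). rewrite addC, Hl. ring.
  - apply lt_ex in H as [z ->]. exists 0.
    assert (E : z * q + q + b = 0).
    { apply addI with (l * q). rewrite add0l. rewrite <- Hl at 2. ring. }
    apply add_eq0 in E as [_ ->]. ring.
Qed.

Lemma common_multiple b : exists m, m <> 0 /\ forall d, d < b -> dv (d + 1) m.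
Proof.
  revert b. apply ind.
  - unfold dv. ars.
  - exists 1. split; [rewrite <- (add0l 1); apply succ_neq0|].
    intros d H. now apply lt0 in H.
  - intros b (m & Hm & H). exists (m * (b + 1)). split.
    + intros E. apply mul_eq0 in E as [E|E]; [auto|now apply succ_neq0 in E].
    + intros d Hd. apply ltS in Hd as [Hd| ->]; [now apply dv_mul, H|].
      exists m. reflexivity.
Qed.

(* Coprimality of the β-moduli [m(i+1)+1], phrased as Euclid's lemma so that no
   primes are needed. *)
Lemma moduli_coprime m b i j x :
  (forall d, d < b -> dv (d + 1) m) -> i < b -> j < b -> i <> j ->
  dv (m * (i + 1) + 1) ((m * (j + 1) + 1) * x) -> dv (m * (i + 1) + 1) x.
Proof.
  intros Hm Hi Hj Hij H. set (q := m * (i + 1) + 1) in *.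
  (* Since [d + 1] divides [m], the hypothesis makes [q] divide [m * (i + 1) * x], which falls short
     of [q * x] by exactly [x]. *)
  assert (A : forall d, d < b -> dv q ((d + 1) * x) -> dv q x).
  { intros d Hd Hx. destruct (Hm d Hd) as [r Hr].
    apply dv_sub with (m * (i + 1) * x).
    - apply (dv_mul (r * (i + 1))) in Hx. rewrite Hr.
      replace (r * (d + 1) * (i + 1) * x) with ((d + 1) * x * (r * (i + 1)));
        [exact Hx|ring].
    - exists x. unfold q. ring. }
  (* Cross-multiplication eliminates [m]: this multiple of [q] and [(m * (j + 1) + 1) * x * (i + 1)]
     differ by [x] times the distance of [i] and [j], which is of the form [d + 1] with [d < b]. *)
  assert (B : dv q (q * (j + 1) * x)) by (exists ((j + 1) * x); ring).
  apply (dv_mul (i + 1)) in H.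
  destruct (lt_total i j) as [L|[E|L]]; [|contradiction|].
  - apply lt_ex in L as [d ->]. apply (A d).
    + eapply lt_trans; [|exact Hj]. apply lt_ex. exists i. ring.
    + eapply dv_sub; [exact H|]. eapply eq_ind; [exact B|]. unfold q. ring.
  - apply lt_ex in L as [d ->]. apply (A d).
    + eapply lt_trans; [|exact Hi]. apply lt_ex. exists j. ring.
    + eapply dv_sub; [exact B|]. eapply eq_ind; [exact H|]. unfold q. ring.
Qed.

Definition fmem (i c : D) : Prop :=
  exists k m n, c = pr k (pr m n) /\ i < k /\ exists q, n = q * (m * (i + 1) + 1).

Definition isTriple (c : D) : Prop := exists k m n, c = pr k (pr m n).

Lemma triple_ex P b : ar (fun e _ => P (e O)) ->
  exists c, isTriple c /\ forall i, fmem i c <-> i < b /\ P i.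
Proof.
  intros HP. destruct (common_multiple b) as (m & Hm0 & Hm).
  (* [n] is the product of the moduli of those [i < u] that satisfy [P]. The second clause,
     coprimality to all other moduli, excludes unwanted elements; it stops at [u = b] because
     coprimality of the moduli is known only below [b]. *)
  assert (H : forall u, exists n,
    (forall i, i < b -> i < u /\ P i -> dv (m * (i + 1) + 1) n) /\
    (u < b + 1 -> forall i, i < b -> ~ (i < u /\ P i) -> forall x,
       dv (m * (i + 1) + 1) (n * x) -> dv (m * (i + 1) + 1) x)).
  { apply ind.
    - unfold dv. ars.
    - exists 1. split; [intros i _ [H _]; now apply lt0 in H|].
      intros _ i _ _ x. now rewrite mul1l.
    - intros u (n & H1 & H2). destruct (classic (P u)) as [Pu|Pu].
      + exists (n * (m * (u + 1) + 1)). split.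
        * intros i Hi [Hu Pi]. apply ltS in Hu as [Hu| ->]; [now apply dv_mul, H1|].
          exists n. reflexivity.
        * intros Hu i Hi Hn x Hx.
          assert (Hu' : u < b).
          { apply ltS in Hu as [Hu|Hu].
            - eapply lt_trans; [apply lt_succ|exact Hu].
            - rewrite <- Hu. apply lt_succ. }
          assert (i <> u). { intros ->. apply Hn. split; [apply lt_succ|exact Pu]. }
          apply (moduli_coprime (b := b) (j := u) Hm); auto.
          apply H2; auto.
          -- apply ltS. now left.
          -- intros [Hu2 Pi]. apply Hn. split; [|exact Pi]. apply ltS. now left.
          -- now rewrite mulA.
      + exists n. split.
        * intros i Hi [Hu Pi]. apply H1; [exact Hi|]. split; [|exact Pi].
          apply ltS in Hu as [Hu| ->]; tauto.
        * intros Hu i Hi Hn. apply H2; [|exact Hi|].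
          -- eapply lt_trans; [apply lt_succ|exact Hu].
          -- intros [Hu2 Pi]. apply Hn. split; [|exact Pi]. apply ltS. now left. }
  destruct (H b) as (n & H1 & H2). exists (pr b (pr m n)). split.
  { exists b, m, n. reflexivity. }
  intros i. split.
  - intros (k' & m' & n' & E & Hi & q & Hq). apply pr_inj in E as [<- E].
    apply pr_inj in E as [<- <-]. split; [exact Hi|]. apply NNPP. intros Pi.
    (* The modulus of an unwanted element would divide 1; but it exceeds 1, as [m] and [i + 1] are
       nonzero. *)
    assert (W : dv (m * (i + 1) + 1) 1).
    { apply (H2 (lt_succ b) i Hi); [tauto|]. exists q. rewrite Hq. ring. }
    destruct W as [k W]. destruct (case0S k) as [->|[z ->]].
    + apply (@succ_neq0 0). rewrite add0l, W. ring.
    + assert (E : z + m * ((i + 1) * (z + 1)) = 0).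
      { apply addI with 1. rewrite add0l. eapply eq_trans; [|symmetry; exact W]. ring. }
      apply add_eq0 in E as [_ E]. apply mul_eq0 in E as [E|E]; [auto|].
      apply mul_eq0 in E as [E|E]; now apply succ_neq0 in E.
  - intros [Hi Pi]. exists b, m, n. split; [reflexivity|]. split; [exact Hi|].
    apply H1; auto.
Qed.

Lemma ar_fmem f g : df f -> df g -> ar (fun e Y => fmem (f e Y) (g e Y)).
Proof. apply (ar_comp2 (P := fmem)). unfold fmem. ars. Qed.

Lemma ar_isTriple f : df f -> ar (fun e Y => isTriple (f e Y)).
Proof. apply (ar_comp1 (P := isTriple)). unfold isTriple. ars. Qed.

Definition isFin (c : D) : Prop :=
  isTriple c
  /\ forall d, d < c -> ~ (isTriple d /\ forall i, fmem i d <-> fmem i c).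

Ltac ar_user ::= first [apply df_pr|apply ar_fmem|apply ar_isTriple].

Lemma ar_isFin f : df f -> ar (fun e Y => isFin (f e Y)).
Proof. apply (ar_comp1 (P := isFin)). unfold isFin. ars. Qed.

Lemma fin_ext c d : isFin c -> isFin d -> (forall i, fmem i c <-> fmem i d) -> c = d.
Proof.
  intros [Hc Hc'] [Hd Hd'] H. destruct (lt_total c d) as [L|[L|L]]; [|exact L|].
  - destruct (Hd' c L). auto.
  - destruct (Hc' d L). split; [exact Hd|]. intros i. now rewrite H.
Qed.

Lemma fin_ex P b : ar (fun e _ => P (e O)) ->
  exists c, isFin c /\ forall i, fmem i c <-> i < b /\ P i.
Proof.
  intros HP.
  destruct (least (P := fun c => isTriple c /\ forall i, fmem i c <-> i < b /\ P i))
    as [c [[H1 H2] H3]]; [ars|now apply triple_ex|].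
  exists c. split; [|exact H2]. split; [exact H1|].
  intros d Hd [H4 H5]. apply (H3 d Hd). split; [exact H4|].
  intros i. now rewrite H5, H2.
Qed.

(** Here and elsewhere [_ < _ + 1] stands for a non-strict inequality. *)
Lemma le_addr x y : x < y + x + 1.
Proof. apply lt_ex. exists y. ring. Qed.

Lemma lt_le_trans x y z : x < y -> y < z + 1 -> x < z.
Proof. intros H1 H2. apply ltS in H2 as [H2| ->]; [eapply lt_trans|]; eauto. Qed.

Lemma le_lt_trans x y z : x < y + 1 -> y < z -> x < z.
Proof. intros H1 H2. apply ltS in H1 as [H1| ->]; [eapply lt_trans|]; eauto. Qed.

Lemma pr_gel a b : a < pr a b + 1.
Proof. apply le_addr. Qed.

(** Elements lie below the first component of the triple, which is at most the code. The
    course-of-values recursion rests on this comparison of sizes. *)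
Lemma fmem_lt i c : fmem i c -> i < c.
Proof.
  intros (k & m & n & -> & H & _). eapply lt_le_trans; [exact H|apply pr_gel].
Qed.

(** * Finite sequences and their operations *)

Definition hasLen (s l : D) : Prop := forall x, x < l <-> exists y, fmem (pr x y) s.

Definition isSeq (s : D) : Prop :=
  isFin s
  /\ (forall x, fmem x s -> exists a b, x = pr a b)
  /\ (forall a b c, fmem (pr a b) s /\ fmem (pr a c) s -> b = c)
  /\ (exists l, hasLen s l).

Definition len (s : D) : D := mu (hasLen s).
Definition at_ (s i : D) : D := mu (fun v => fmem (pr i v) s).

Lemma ar_hasLen f g : df f -> df g -> ar (fun e Y => hasLen (f e Y) (g e Y)).
Proof. apply (ar_comp2 (P := hasLen)). unfold hasLen. ars. Qed.

Ltac ar_user ::= first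
  [apply df_pr|apply ar_fmem|apply ar_isTriple|apply ar_isFin|apply ar_hasLen].

Lemma ar_isSeq f : df f -> ar (fun e Y => isSeq (f e Y)).
Proof. apply (ar_comp1 (P := isSeq)). unfold isSeq. ars. Qed.

Lemma df_len f : df f -> df (fun e Y => len (f e Y)).
Proof. apply df_comp1. apply df_mu. ars. Qed.

Lemma df_at f g : df f -> df g -> df (fun e Y => at_ (f e Y) (g e Y)).
Proof. apply df_comp2. apply df_mu. ars. Qed.

Ltac ar_user ::= first
  [apply df_pr|apply df_len|apply df_at|apply ar_fmem|apply ar_isTriple
  |apply ar_isFin|apply ar_hasLen|apply ar_isSeq].

Lemma len_unique s l l' : hasLen s l -> hasLen s l' -> l = l'.
Proof.
  intros H H'. destruct (lt_total l l') as [L|[L|L]]; [|exact L|].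
  - apply H', H in L. now apply lt_irrefl in L.
  - apply H, H' in L. now apply lt_irrefl in L.
Qed.

Lemma seq_len s : isSeq s -> hasLen s (len s).
Proof. intros (_ & _ & _ & H). apply (mu_spec (P := hasLen s)); [ars|exact H]. Qed.

Lemma len_eq s l : isSeq s -> hasLen s l -> len s = l.
Proof. intros H. now apply len_unique, seq_len. Qed.

Lemma seq_at s i v : isSeq s -> fmem (pr i v) s <-> i < len s /\ v = at_ s i.
Proof.
  intros Hs. assert (A : i < len s -> fmem (pr i (at_ s i)) s).
  { intros H. apply (mu_spec (P := fun v => fmem (pr i v) s)); [ars|].
    now apply (seq_len Hs). }
  split.
  - intros H. assert (L : i < len s) by (apply (seq_len Hs); eauto).
    split; [exact L|]. destruct Hs as (_ & _ & Hf & _). eauto.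
  - intros [H ->]. auto.
Qed.

Lemma seq_mem s x : isSeq s -> fmem x s <-> exists i, i < len s /\ x = pr i (at_ s i).
Proof.
  intros Hs. split.
  - intros H. destruct Hs as (H1 & H2 & H3). destruct (H2 x H) as (i & v & ->).
    apply seq_at in H as [H ->]; [|now split]. eauto.
  - intros (i & Hi & ->). now apply seq_at.
Qed.

Lemma seq_ext s t : isSeq s -> isSeq t -> len s = len t ->
  (forall i, i < len s -> at_ s i = at_ t i) -> s = t.
Proof.
  intros Hs Ht E H. apply fin_ext; [apply Hs|apply Ht|]. intros x.
  rewrite !seq_mem by assumption. rewrite <- E.
  split; intros (i & Hi & ->); exists i; rewrite ?H by assumption; auto.
Qed.

Lemma seq_ex f l : df (fun e _ => f (e O)) ->
  exists s, isSeq s /\ len s = l /\ forall i, i < l -> at_ s i = f i.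
Proof.
  (* A coded finite set needs a bound given in advance, so the graph of [f] below [l] is first
     bounded by induction. *)
  intros Hf. assert (B : forall l, exists b, forall i, i < l -> pr i (f i) < b).
  { apply ind.
    - ars.
    - exists 0. intros i H. now apply lt0 in H.
    - intros n [b Hb]. exists (b + pr n (f n) + 1). intros i Hi.
      apply ltS in Hi as [Hi| ->]; [|apply le_addr].
      eapply lt_trans; [now apply Hb|]. apply lt_ex. exists (pr n (f n)). ring. }
  destruct (B l) as [b Hb].
  destruct (@fin_ex (fun x => exists i, i < l /\ x = pr i (f i)) b) as [s [H1 H2]];
    [ars|].
  assert (E : forall i v, fmem (pr i v) s <-> i < l /\ v = f i).
  { intros i v. rewrite H2. split.
    - intros (_ & j & Hj & E). now apply pr_inj in E as [-> ->].
    - intros [Hi ->]. eauto. }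
  assert (L : hasLen s l).
  { intros i. split.
    - intros Hi. exists (f i). now apply E.
    - intros [v H]. now apply E in H. }
  assert (Hs : isSeq s).
  { split; [exact H1|]. split; [|split; [|now exists l]].
    - intros x Hx. apply H2 in Hx as (_ & i & _ & ->). eauto.
    - intros i v w [Hv Hw]. apply E in Hv as [_ ->], Hw as [_ ->]. reflexivity. }
  exists s. split; [exact Hs|]. split; [now apply len_eq|].
  intros i Hi. symmetry. apply (seq_at i (f i) Hs), E. auto.
Qed.

Lemma idx_lt s i : isSeq s -> i < len s -> i < s.
Proof.
  intros Hs Hi. eapply le_lt_trans; [apply pr_gel|]. apply fmem_lt, seq_at; eauto.
Qed.

Lemma lt_le x y : x < y -> x < y + 1.
Proof. intros H. apply ltS. now left. Qed.

Lemma succ_le x y : x + 1 < y + 1 <-> x < y.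
Proof.
  split; [|apply lt_SS]. intros H. eapply lt_le_trans; [apply lt_succ|exact H].
Qed.

Lemma seq_ex_rel R l : ar (fun e _ => R (e O) (e 1%nat)) ->
  (forall i, i < l -> exists v, R i v) ->
  exists s, isSeq s /\ len s = l /\ forall i, i < l -> R i (at_ s i).
Proof.
  intros HR H. destruct (@seq_ex (fun i => mu (R i)) l) as (s & H1 & H2 & H3).
  - apply df_mu. ars.
  - exists s. split; [exact H1|]. split; [exact H2|]. intros i Hi.
    rewrite H3 by exact Hi. apply mu_spec; [ars|auto].
Qed.

Definition snil : D := mu (fun s => isSeq s /\ len s = 0).

Definition snoc (s n : D) : D := mu (fun t =>
  isSeq t /\ len t = len s + 1 /\ at_ t (len s) = n /\
  forall i, i < len s -> at_ t i = at_ s i).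

Definition restr (s k : D) : D := mu (fun t =>
  isSeq t /\ len t = k /\ forall i, i < k -> at_ t i = at_ s i).

Definition frestr (f : D -> D) (k : D) : D := mu (fun t =>
  isSeq t /\ len t = k /\ forall i, i < k -> at_ t i = f i).

Lemma df_snoc f g : df f -> df g -> df (fun e Y => snoc (f e Y) (g e Y)).
Proof. apply df_comp2. apply df_mu. ars. Qed.

Lemma df_restr f g : df f -> df g -> df (fun e Y => restr (f e Y) (g e Y)).
Proof. apply df_comp2. apply df_mu. ars. Qed.

Lemma df_frestr h f : df (fun e _ => h (e O)) -> df f ->
  df (fun e Y => frestr h (f e Y)).
Proof. intros Hh. apply df_comp1. apply df_mu. ars. Qed.

Ltac ar_user ::= first
  [apply df_pr|apply df_len|apply df_at|apply df_snoc|apply df_restr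
  |apply df_frestr; [assumption|]
  |apply ar_fmem|apply ar_isTriple|apply ar_isFin|apply ar_hasLen|apply ar_isSeq].

Lemma snil_spec : isSeq snil /\ len snil = 0.
Proof.
  apply (mu_spec (P := fun s => isSeq s /\ len s = 0)); [ars|].
  destruct (@seq_ex (fun x => x) 0) as (s & H1 & H2 & _); [ars|eauto].
Qed.

Lemma snil_unique s : isSeq s -> len s = 0 -> s = snil.
Proof.
  intros H1 H2. destruct snil_spec as [H3 H4].
  apply seq_ext; [assumption..|congruence|]. intros i Hi. rewrite H2 in Hi.
  now apply lt0 in Hi.
Qed.

Lemma snoc_spec s n : isSeq (snoc s n) /\ len (snoc s n) = len s + 1 /\
  at_ (snoc s n) (len s) = n /\ forall i, i < len s -> at_ (snoc s n) i = at_ s i.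
Proof.
  apply (mu_spec (P := fun t => isSeq t /\ len t = len s + 1 /\ at_ t (len s) = n /\
    forall i, i < len s -> at_ t i = at_ s i)); [ars|].
  destruct (@seq_ex_rel (fun i v => (i = len s -> v = n) /\ (i < len s -> v = at_ s i))
    (len s + 1)) as (t & H1 & H2 & H3); [ars| |].
  - intros i Hi. destruct (classic (i = len s)) as [->|E].
    + exists n. split; [auto|]. intros H. now apply lt_irrefl in H.
    + exists (at_ s i). tauto.
  - exists t. split; [exact H1|]. split; [exact H2|]. split.
    + apply H3; [apply lt_succ|reflexivity].
    + intros i Hi. apply H3; [now apply lt_le|exact Hi].
Qed.

Lemma restr_spec s k : isSeq (restr s k) /\ len (restr s k) = k /\
  forall i, i < k -> at_ (restr s k) i = at_ s i.
Proof.
  apply (mu_spec (P := fun t => isSeq t /\ len t = k /\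
    forall i, i < k -> at_ t i = at_ s i)); [ars|].
  apply (@seq_ex (at_ s)). ars.
Qed.

Lemma frestr_spec f k : df (fun e _ => f (e O)) ->
  isSeq (frestr f k) /\ len (frestr f k) = k /\
  forall i, i < k -> at_ (frestr f k) i = f i.
Proof.
  intros Hf. apply (mu_spec (P := fun t => isSeq t /\ len t = k /\
    forall i, i < k -> at_ t i = f i)); [ars|].
  apply (@seq_ex f). ars.
Qed.

Lemma restr_eq s t k : isSeq t -> len t = k ->
  (forall i, i < k -> at_ t i = at_ s i) -> restr s k = t.
Proof.
  intros H1 H2 H3. destruct (restr_spec s k) as (H4 & H5 & H6).
  apply seq_ext; [assumption..|congruence|]. intros i Hi. rewrite H5 in Hi.
  rewrite H6, H3 by exact Hi. reflexivity.
Qed.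

Lemma frestr_eq f t k : df (fun e _ => f (e O)) -> isSeq t -> len t = k ->
  (forall i, i < k -> at_ t i = f i) -> frestr f k = t.
Proof.
  intros Hf H1 H2 H3. destruct (frestr_spec k Hf) as (H4 & H5 & H6).
  apply seq_ext; [assumption..|congruence|]. intros i Hi. rewrite H5 in Hi.
  rewrite H6, H3 by exact Hi. reflexivity.
Qed.

Lemma restr_len s : isSeq s -> restr s (len s) = s.
Proof. intros H. now apply restr_eq. Qed.

Lemma restr_0 s : restr s 0 = snil.
Proof. destruct (restr_spec s 0) as (H1 & H2 & _). now apply snil_unique. Qed.

Lemma frestr_0 f : df (fun e _ => f (e O)) -> frestr f 0 = snil.
Proof.
  intros Hf. destruct (frestr_spec 0 Hf) as (H1 & H2 & _). now apply snil_unique.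
Qed.

Lemma restr_restr s k l : k < l + 1 -> restr (restr s l) k = restr s k.
Proof.
  intros H. destruct (restr_spec s k) as (H1 & H2 & H3), (restr_spec s l) as (_ & _ & H4).
  apply restr_eq; auto. intros i Hi. rewrite H3, H4; [reflexivity| |exact Hi].
  eapply lt_le_trans; eauto.
Qed.

Lemma restr_frestr f k l : df (fun e _ => f (e O)) -> k < l + 1 ->
  restr (frestr f l) k = frestr f k.
Proof.
  intros Hf H. destruct (frestr_spec k Hf) as (H1 & H2 & H3), (frestr_spec l Hf) as (_ & _ & H4).
  apply restr_eq; auto. intros i Hi. rewrite H3, H4; [reflexivity| |exact Hi].
  eapply lt_le_trans; eauto.
Qed.

Lemma restr_snoc s n k : k < len s + 1 -> restr (snoc s n) k = restr s k.
Proof.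
  intros H. destruct (restr_spec s k) as (H1 & H2 & H3), (snoc_spec s n) as (_ & _ & _ & H4).
  apply restr_eq; auto. intros i Hi. rewrite H3, H4; [reflexivity| |exact Hi].
  eapply lt_le_trans; eauto.
Qed.

(** * Recursion on numbers *)

Lemma prim_rec G a : df (fun e _ => G (e O) (e 1%nat)) ->
  exists f, df (fun e _ => f (e O)) /\ f 0 = a /\ forall n, f (n + 1) = G n (f n).
Proof.
  intros HG.
  set (R := fun n s => isSeq s /\ len s = n + 1 /\ at_ s 0 = a /\
    forall i, i < n -> at_ s (i + 1) = G i (at_ s i)).
  assert (HR : ar (fun e _ => R (e O) (e 1%nat))) by (unfold R; ars).
  assert (E : forall n, exists s, R n s).
  { apply ind.
    - ars.
    - destruct (@seq_ex (fun _ => a) 1) as (s & H1 & H2 & H3); [ars|].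
      exists s. split; [exact H1|]. split; [now rewrite add0l|]. split.
      + apply H3. rewrite <- (add0l 1). apply lt_succ.
      + intros i Hi. now apply lt0 in Hi.
    - intros n (s & H1 & H2 & H3 & H4). exists (snoc s (G n (at_ s n))).
      destruct (snoc_spec s (G n (at_ s n))) as (H5 & H6 & H7 & H8).
      rewrite H2 in *. split; [exact H5|]. split; [exact H6|]. split.
      + rewrite H8; [exact H3|apply lt_0S].
      + intros i Hi. rewrite (H8 i Hi). apply ltS in Hi as [Hi| ->].
        * rewrite H8; [now apply H4|now apply succ_le].
        * exact H7. }
  assert (U : forall m n s t, R m s -> R n t -> forall i, i < m + 1 -> i < n + 1 ->
    at_ s i = at_ t i).
  { intros m n s t (_ & _ & H3 & H4) (_ & _ & H7 & H8). apply (ind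
      (P := fun i => i < m + 1 -> i < n + 1 -> at_ s i = at_ t i)).
    - ars.
    - congruence.
    - intros i IH Hi Hj. apply (proj1 (succ_le _ _)) in Hi, Hj.
      rewrite H4, H8 by assumption. f_equal. apply IH; now apply lt_le. }
  exists (fun n => at_ (mu (R n)) n).
  assert (Hf : forall n, R n (mu (R n))) by (intros n; apply mu_spec; [ars|auto]).
  split; [|split].
  - apply (df_at (f := fun e Y => mu (R (e O)))); [|ars]. apply df_mu. ars.
  - apply (Hf 0).
  - intros n. destruct (Hf (n + 1)) as (_ & _ & _ & H). rewrite H by apply lt_succ.
    f_equal. apply (U (n + 1) n); auto using lt_le, lt_succ.
Qed.

(** The part of [T] below [s] is carried along as a coded finite set [f s], which reduces
    course-of-values recursion to primitive recursion. *)
Lemma cov_rec Phi : ar (fun e _ => Phi (e O) (e 1%nat)) ->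
  exists T, forall s, exists c,
    (forall i, fmem i c <-> i < s /\ i ∈ T) /\ (s ∈ T <-> Phi s c).
Proof.
  intros HPhi.
  set (R := fun n c d => isFin d /\ forall i, fmem i d <-> fmem i c \/ (i = n /\ Phi n c)).
  destruct (@fin_ex (fun _ => False) 0) as [c0 [_ Hc0]]; [ars|].
  destruct (@prim_rec (fun n c => mu (R n c)) c0) as (f & Hf & H0 & HS).
  { apply df_mu. unfold R. ars. }
  assert (E : forall n i, fmem i (f (n + 1)) <-> fmem i (f n) \/ (i = n /\ Phi n (f n))).
  { intros n. rewrite HS. apply (mu_spec (P := R n (f n))); [unfold R; ars|].
    (* The bound covers the old elements, each below the code [f n], and the possible new element
       [n]. *)
    destruct (@fin_ex (fun i => fmem i (f n) \/ (i = n /\ Phi n (f n))) (f n + n + 1))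
      as [d [H1 H2]]; [ars|]. exists d. split; [exact H1|]. intros i. rewrite H2.
    split; [tauto|]. intros H. split; [|exact H]. destruct H as [H|[-> _]].
    - eapply lt_trans; [exact (fmem_lt H)|]. apply lt_ex. exists n. ring.
    - apply le_addr. }
  destruct (@comp (fun s => Phi s (f s))) as [T HT].
  { apply (ar_comp2 (P := Phi) (f := fun e _ => e O) (g := fun e _ => f (e O))); ars. }
  exists T. intros s. exists (f s). split; [|apply HT].
  revert s. apply (ind (P := fun s => forall i, fmem i (f s) <-> i < s /\ i ∈ T)).
  - ars.
  - intros i. rewrite H0, Hc0. split; intros [H1 H2]; [tauto|now apply lt0 in H1].
  - intros s IH i. rewrite E, IH, ltS. split.
    + intros [[H1 H2]|[-> H]]; [tauto|]. split; [now right|now apply HT].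
    + intros [[H1| ->] H2]; [tauto|]. right. split; [reflexivity|now apply HT].
Qed.

(** * Functions as graphs, well-orders and descending sequences *)

Lemma graph_ex f : df (fun e _ => f (e O)) ->
  exists F, isFun F /\ forall x y, pr x y ∈ F <-> y = f x.
Proof.
  intros Hf. destruct (@comp (fun z => exists x, z = pr x (f x))) as [F HF]; [ars|].
  assert (E : forall x y, pr x y ∈ F <-> y = f x).
  { intros x y. rewrite HF. split; [|intros ->; eauto].
    intros [x' H]. now apply pr_inj in H as [-> ->]. }
  exists F. split; [|exact E]. split; [|split].
  - intros z Hz. apply HF in Hz as [x ->]. eauto.
  - intros x y z [H1 H2]. apply E in H1, H2. congruence.
  - intros x. exists (f x). now apply E.
Qed.

Lemma fun_of_graph F : isFun F ->
  exists f, df (fun e _ => f (e O)) /\ forall x y, pr x y ∈ F <-> y = f x.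
Proof.
  intros (_ & H2 & H3). exists (fun x => mu (fun y => pr x y ∈ F)).
  assert (E : forall x, pr x (mu (fun y => pr x y ∈ F)) ∈ F).
  { intros x. apply (mu_spec (P := fun y => pr x y ∈ F)); [ars|auto]. }
  split; [apply df_mu; ars|]. intros x y. split; [eauto|now intros ->].
Qed.

Lemma ar_rlt X f g : df f -> df g -> ar (fun e Y => rlt X (f e Y) (g e Y)).
Proof. apply (ar_comp2 (P := rlt X)). unfold rlt, rle. ars. Qed.

Lemma ar_rle X f g : df f -> df g -> ar (fun e Y => rle X (f e Y) (g e Y)).
Proof. apply (ar_comp2 (P := rle X)). unfold rle. ars. Qed.

Ltac ar_user ::= first
  [apply df_pr|apply df_len|apply df_at|apply df_snoc|apply df_restr
  |apply df_frestr; [assumption|]|apply ar_rlt|apply ar_rle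
  |apply ar_fmem|apply ar_isTriple|apply ar_isFin|apply ar_hasLen|apply ar_isSeq].

Lemma WO_no_descent X g : isWO X -> df (fun e _ => g (e O)) ->
  ~ forall n, rlt X (g (n + 1)) (g n).
Proof.
  intros [_ HX] Hg H. destruct (graph_ex Hg) as [F [H1 H2]]. apply HX.
  exists F. split; [exact H1|]. intros n. exists (g n), (g (n + 1)).
  rewrite !H2. auto.
Qed.

Lemma not_WO_descent X : isLO X -> ~ isWO X ->
  exists g, df (fun e _ => g (e O)) /\ forall n, rlt X (g (n + 1)) (g n).
Proof.
  intros HL HX. apply NNPP. intros N. apply HX. split; [exact HL|].
  intros [F [HF H]]. destruct (fun_of_graph HF) as [f [H1 H2]]. apply N.
  exists f. split; [exact H1|]. intros n. destruct (H n) as (a & b & Ha & Hb & Hab).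
  apply H2 in Ha, Hb. congruence.
Qed.

(** Without a minimal element, repeatedly choosing the numerically least member of [P] below the
    current one gives an arithmetical descending sequence. *)
Lemma WO_least X P : isWO X -> ar (fun e _ => P (e O)) -> (exists j, P j) ->
  exists j, P j /\ forall i, rlt X i j -> ~ P i.
Proof.
  intros HX HP [j0 Hj0]. apply NNPP. intros N.
  assert (H : forall j, P j -> exists i, rlt X i j /\ P i).
  { intros j Hj. apply NNPP. intros H. apply N. exists j. split; [exact Hj|]. eauto. }
  destruct (@prim_rec (fun _ j => mu (fun i => rlt X i j /\ P i)) j0)
    as (g & Hg & H0 & HS); [apply df_mu; ars|].
  assert (A : forall j, P j -> rlt X (mu (fun i => rlt X i j /\ P i)) j /\
    P (mu (fun i => rlt X i j /\ P i))).
  { intros j Hj. apply (mu_spec (P := fun i => rlt X i j /\ P i)); [ars|auto]. }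
  assert (B : forall n, P (g n)).
  { apply (ind (P := fun n => P (g n))); [ars|congruence|].
    intros n Hn. rewrite HS. now apply A. }
  apply (WO_no_descent HX Hg). intros n. rewrite HS. now apply A.
Qed.

(** * The game *)

(** The Kleene-Brouwer order on sequences. *)
Definition klt (s t : D) : Prop := exists i, i < len s /\
  (forall j, j < i -> at_ s j = at_ t j) /\
  ((i < len t /\ at_ s i < at_ t i) \/ i = len t).

Lemma ar_klt f g : df f -> df g -> ar (fun e Y => klt (f e Y) (g e Y)).
Proof. apply (ar_comp2 (P := klt)). unfold klt. ars. Qed.

Lemma klt_irrefl s : ~ klt s s.
Proof.
  intros (i & Hi & _ & [[_ H]|H]); [now apply lt_irrefl in H|].
  subst i. now apply lt_irrefl in Hi.
Qed.

Lemma klt_trans s t u : klt s t -> klt t u -> klt s u.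
Proof.
  intros (i & Hi & E & H) (j & Hj & E' & H').
  destruct (lt_total i j) as [L|[<-|L]].
  - exists i. split; [exact Hi|]. split.
    + intros k Hk. rewrite E by exact Hk. apply E'. eapply lt_trans; eauto.
    + left. destruct H as [[_ H]| ->].
      * rewrite <- (E' i L). split; [|exact H].
        destruct H' as [[H' _]| <-]; [eapply lt_trans; eauto|exact L].
      * exfalso. apply (@lt_irrefl j). eapply lt_trans; eauto.
  - exists i. split; [exact Hi|]. split.
    + intros k Hk. rewrite E by exact Hk. now apply E'.
    + destruct H as [[_ H]| ->]; [|now apply lt_irrefl in Hj].
      destruct H' as [[H1 H2]|H']; [left|now right]. split; [exact H1|].
      eapply lt_trans; eauto.
  - exists j. split; [eapply lt_trans; eauto|]. split.
    + intros k Hk. rewrite E; [now apply E'|]. eapply lt_trans; eauto.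
    + now rewrite E.
Qed.

Lemma klt_total s t : isSeq s -> isSeq t -> klt s t \/ s = t \/ klt t s.
Proof.
  intros Hs Ht.
  (* The least [i] with [P i] is the first place where the sequences differ or exactly one of them
     has ended. *)
  set (P := fun i => (i < len s \/ i < len t) /\
    ~ (i < len s /\ i < len t /\ at_ s i = at_ t i)).
  assert (HP : ar (fun e _ => P (e O))) by (unfold P; ars).
  destruct (classic (exists i, P i)) as [H|H].
  - destruct (least HP H) as [i [[H1 H2] H3]].
    assert (B : forall j, j < i -> j < len s /\ j < len t /\ at_ s j = at_ t j).
    { intros j Hj. apply NNPP. intros N. apply (H3 j Hj). split; [|exact N].
      destruct H1 as [H1|H1]; [left|right]; eapply lt_trans; eauto. }
    assert (G : forall s t, i < len s -> ~ i < len t ->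
      (forall j, j < i -> j < len s /\ j < len t /\ at_ s j = at_ t j) -> klt s t).
    { intros s' t' L1 L2 B'. exists i. split; [exact L1|].
      split; [intros j Hj; now apply B'|]. right.
      destruct (lt_total i (len t')) as [L|[L|L]]; [tauto|exact L|].
      destruct (B' _ L) as (_ & L' & _). now apply lt_irrefl in L'. }
    destruct (classic (i < len s)) as [L1|L1], (classic (i < len t)) as [L2|L2].
    + destruct (lt_total (at_ s i) (at_ t i)) as [L|[L|L]]; [|tauto|].
      * left. exists i. split; [exact L1|]. split; [intros j Hj; now apply B|tauto].
      * right. right. exists i. split; [exact L2|].
        split; [intros j Hj; symmetry; now apply B|tauto].
    + left. now apply G.
    + right. right. apply G; [assumption..|]. intros j Hj.
      destruct (B j Hj) as (? & ? & ?). auto.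
    + tauto.
  - right. left. assert (E : len s = len t).
    { destruct (lt_total (len s) (len t)) as [L|[L|L]]; [|exact L|]; exfalso.
      - apply H. exists (len s). split; [tauto|].
        intros [L' _]. now apply lt_irrefl in L'.
      - apply H. exists (len t). split; [tauto|].
        intros (_ & L' & _). now apply lt_irrefl in L'. }
    apply seq_ext; auto. intros i Hi. apply NNPP. intros N. apply H. exists i.
    split; [tauto|]. tauto.
Qed.

Ltac ar_user ::= first
  [apply df_pr|apply df_len|apply df_at|apply df_snoc|apply df_restr
  |apply df_frestr; [assumption|]|apply ar_rlt|apply ar_rle|apply ar_klt
  |apply ar_fmem|apply ar_isTriple|apply ar_isFin|apply ar_hasLen|apply ar_isSeq].

Definition tree (T : sets M) : Prop := forall s, s ∈ T ->
  isSeq s /\ forall k, k < len s + 1 -> restr s k ∈ T.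

Lemma KB_ex T : (forall s, s ∈ T -> isSeq s) -> exists L, isLO L /\
  (forall s t, rle L s t <-> s ∈ T /\ t ∈ T /\ (s = t \/ klt s t)) /\
  (forall s t, rlt L s t <-> s ∈ T /\ t ∈ T /\ klt s t).
Proof.
  intros HT.
  destruct (@comp (fun z => exists s t, z = pr s t /\
    s ∈ T /\ t ∈ T /\ (s = t \/ klt s t))) as [L HL]; [ars|].
  assert (E : forall s t, rle L s t <-> s ∈ T /\ t ∈ T /\ (s = t \/ klt s t)).
  { intros s t. unfold rle. rewrite HL. split; [|eauto].
    intros (s' & t' & E & H). now apply pr_inj in E as [-> ->]. }
  exists L. split; [|split; [exact E|]].
  - split; [|split; [|split; [|split]]].
    + intros z Hz. apply HL in Hz as (s & t & -> & _). eauto.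
    + intros s t. rewrite !E. tauto.
    + intros s t u. rewrite !E. intros [(H1 & H2 & [->|H3]) (H4 & H5 & [->|H6])]; auto.
      split; [auto|]. split; [auto|]. right. eapply klt_trans; eauto.
    + intros s t. rewrite !E. intros [(H1 & H2 & [H3|H3]) (H4 & H5 & [H6|H6])]; auto.
      destruct (klt_irrefl (klt_trans H3 H6)).
    + intros s t. rewrite !E. intros [(H1 & _) (H2 & _)].
      destruct (klt_total (HT s H1) (HT t H2)) as [H|[H|H]]; auto 6.
  - intros s t. unfold rlt. rewrite !E. split.
    + intros [(H1 & H2 & [->|H3]) H4]; [tauto|auto].
    + intros (H1 & H2 & H3). split; [auto|]. intros (_ & _ & [->|H4]).
      * now apply klt_irrefl in H3.
      * exact (klt_irrefl (klt_trans H3 H4)).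
Qed.

(** Along a Kleene-Brouwer descent the entries stabilise one coordinate after the other, and the
    limits form a path. [stable l N] says that from stage [N] on the first [l] entries exist and no
    longer change. *)
Lemma descent_path T g : tree T -> df (fun e _ => g (e O)) ->
  (forall n, g n ∈ T /\ klt (g (n + 1)) (g n)) ->
  exists p, df (fun e _ => p (e O)) /\ forall n, frestr p n ∈ T.
Proof.
  intros HT Hg H.
  set (stable := fun l N => forall k, N < k + 1 ->
    l < len (g k) + 1 /\ forall j, j < l -> at_ (g k) j = at_ (g N) j).
  assert (Hst : ar (fun e _ => stable (e O) (e 1%nat))) by (unfold stable; ars).
  assert (E : forall l, exists N, stable l N).
  { apply ind; [ars| |].
    - exists 0. intros k _. split; [apply lt_0S|]. intros j Hj. now apply lt0 in Hj.
    - intros l [N HN].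
      (* With the first [l] entries fixed, the place [i] of the descent is at least [l]; so entry
         [l] exists at the next stage and does not exceed its previous value, if there was one. *)
      assert (A : forall k, N < k + 1 -> l < len (g (k + 1)) /\
        (l < len (g k) -> at_ (g (k + 1)) l < at_ (g k) l + 1)).
      { intros k Hk. destruct (H k) as [_ (i & Hi & Hij & Hi')].
        assert (Hk' : N < k + 1 + 1) by now apply lt_le.
        assert (L : l < i + 1).
        { destruct (lt_total i l) as [L|[->|L]]; [|apply lt_succ|now apply lt_le].
          exfalso. destruct Hi' as [[_ Hi']| ->].
          - rewrite (proj2 (HN _ Hk) i L), (proj2 (HN _ Hk') i L) in Hi'.
            now apply lt_irrefl in Hi'.
          - apply (@lt_irrefl l). eapply le_lt_trans; [apply (HN _ Hk)|exact L]. }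
        split; [eapply le_lt_trans; eauto|]. intros Hl.
        apply ltS in L as [L| ->].
        - rewrite (Hij l L). apply lt_succ.
        - destruct Hi' as [[_ Hi']| ->]; [now apply lt_le|now apply lt_irrefl in Hl]. }
      (* Entry [l] is sure to exist only after stage [N], hence the shift to [N + 1]. Its least
         value [v], once reached at stage [K], is kept forever. *)
      destruct (@least (fun v => exists k, N + 1 < k + 1 /\ at_ (g k) l = v))
        as [v [[K [HK Hv]] Hmin]]; [ars|exists (at_ (g (N + 1)) l), (N + 1);
        split; [apply lt_succ|reflexivity]|].
      assert (L : forall k, N + 1 < k + 1 -> l < len (g k)).
      { intros k Hk. apply (proj1 (succ_le _ _)) in Hk. apply lt_ex in Hk as [z ->].
        apply A. apply lt_ex. exists z. reflexivity. }
      assert (B : forall d, at_ (g (K + d)) l = v /\ N + 1 < K + d + 1).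
      { apply ind; [ars|now rewrite add0r|]. intros d [Hd1 Hd2].
        assert (Hd3 : N + 1 < K + (d + 1) + 1).
        { rewrite addA. now apply lt_le. }
        split; [|exact Hd3].
        destruct (lt_total (at_ (g (K + (d + 1))) l) v) as [X|[X|X]]; [|exact X|].
        - destruct (Hmin _ X). eauto.
        - exfalso. rewrite addA in X. apply (proj1 (succ_le _ _)) in Hd2.
          destruct (A (K + d)) as [_ A'].
          { now apply lt_le. }
          rewrite Hd1 in A'. apply (@lt_irrefl v).
          eapply lt_le_trans; [exact X|]. apply A', L. now apply lt_SS. }
      exists K. intros k Hk. assert (Hk' : exists d, k = K + d).
      { apply ltS in Hk as [Hk| ->]; [|exists 0; now rewrite add0r].
        apply lt_ex in Hk as [d ->]. exists (d + 1). ring. }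
      destruct Hk' as [d ->]. destruct (B d) as [B1 B2]. split.
      + apply lt_SS, L, B2.
      + intros j Hj. apply ltS in Hj as [Hj| ->].
        * transitivity (at_ (g N) j); [|symmetry]; apply HN; try exact Hj.
          -- eapply lt_trans; [apply lt_succ|exact B2].
          -- eapply lt_trans; [apply lt_succ|exact HK].
        * destruct (B 0) as [B3 _]. rewrite add0r in B3. congruence. }
  set (p := fun l => mu (fun v => exists N, stable (l + 1) N /\ at_ (g N) l = v)).
  exists p.
  assert (Hp : df (fun e _ => p (e O))).
  { unfold p. apply df_mu. ars. }
  split; [exact Hp|]. intros n. destruct (E n) as [N HN].
  rewrite (frestr_eq (t := restr (g N) n)).
  - apply (HT (g N)); [apply H|]. apply HN, lt_succ.
  - exact Hp.
  - apply restr_spec.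
  - apply restr_spec.
  - intros i Hi. destruct (restr_spec (g N) n) as (_ & _ & R). rewrite R by exact Hi.
    assert (Q : exists N, stable (i + 1) N /\ at_ (g N) i = p i).
    { apply (mu_spec (P := fun v => exists N, stable (i + 1) N /\ at_ (g N) i = v)).
      - ars.
      - destruct (E (i + 1)) as [N' HN']. eauto. }
    destruct Q as (N' & HN' & <-). destruct (lt_total N N') as [L|[->|L]].
    + symmetry. apply HN; [now apply lt_le|exact Hi].
    + reflexivity.
    + apply HN'; [now apply lt_le|apply lt_succ].
Qed.

Lemma transfinite_pairs Phi X : ar (fun e Z => Phi (e O) Z) -> isWO X ->
  exists Y, forall n j, pr n j ∈ Y <-> rle X j j /\
    exists Z, isBelow X Y j Z /\ Phi n Z.
Proof.
  intros (th & v & Hth & HPhi) HX.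
  destruct (@transfinite_rec th Hth (env []) v X HX) as [Y HY].
  exists Y. intros n j. rewrite HY. split.
  - intros (n' & j' & E & Hj & Z & HZ & H). apply pr_inj in E as [<- <-].
    split; [exact Hj|]. exists Z. split; [exact HZ|now apply HPhi in H].
  - intros (Hj & Z & HZ & H). exists n, j. split; [reflexivity|].
    split; [exact Hj|]. exists Z. split; [exact HZ|now apply HPhi].
Qed.

Lemma below_ex X Y j : exists Z, isBelow X Y j Z /\
  forall m i, pr m i ∈ Z <-> rlt X i j /\ pr m i ∈ Y.
Proof.
  destruct (@comp (fun x => exists m i, x = pr m i /\ rlt X i j /\ x ∈ Y))
    as [Z HZ]; [ars|].
  exists Z. split; [exact HZ|]. intros m i. rewrite HZ. split; [|eauto].
  intros (m' & i' & E & H). now apply pr_inj in E as [<- <-].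
Qed.

(** * Positions, strategies and the dichotomy for an abstract move relation *)

Section Game.
Context (A : sets M) (C : D -> D -> Prop).
Context (HC : ar (fun e _ => C (e O) (e 1%nat))).
Context (C_total : forall v, v <> 0 -> exists n, C v n).

(** Quantifiers of the player who avoids, respectively enters, the open set
    coded by [A]: at each position the latter challenges with [k], the former
    answers with [v > k + 1], and the latter chooses a move [n] with [C v n].  For
    [C v n := v <= n] these are "for all but finitely many [n]" and "for
    infinitely many [n]"; for [C v n := (v = n + 1)] the other way round. *)
Definition Qc (P : D -> Prop) : Prop :=
  forall k, exists v, k + 1 < v /\ forall n, C v n -> P n.
Definition Qo (P : D -> Prop) : Prop :=
  exists k, forall v, k + 1 < v -> exists n, C v n /\ P n.

Lemma Qc_or_Qo P : Qc P \/ Qo (fun n => ~ P n).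
Proof.
  destruct (classic (Qc P)) as [H|H]; [now left|right].
  apply not_all_ex_not in H as [k Hk]. exists k. intros v Hv.
  apply NNPP. intros N. apply Hk. exists v. split; [exact Hv|].
  intros n Hn. apply NNPP. intros HP. eauto.
Qed.

Lemma Qo_mono (P P' : D -> Prop) : (forall n, P n -> P' n) -> Qo P -> Qo P'.
Proof.
  intros H [k HP]. exists k. intros v Hv. destruct (HP v Hv) as (n & H1 & H2). eauto.
Qed.

(** The code [A] need not be closed under extensions, so initial segments are inspected as well. *)
Definition hit (s : D) : Prop := exists k, k < len s + 1 /\ restr s k ∈ A.

Lemma ar_hit f : df f -> ar (fun e Y => hit (f e Y)).
Proof. apply (ar_comp1 (P := hit)). unfold hit. ars. Qed.

Lemma hit_restr s k : k < len s + 1 -> hit (restr s k) -> hit s.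
Proof.
  intros Hk (l & Hl & H). destruct (restr_spec s k) as (_ & E & _). rewrite E in Hl.
  rewrite restr_restr in H by exact Hl. exists l. split; [|exact H].
  apply ltS in Hl as [Hl| ->]; [eapply lt_trans|]; eauto.
Qed.

(** Paths are maps with arithmetical graph; [fun_of_graph] provides such a map for every function of
    the model. *)
Definition open_tree (T : sets M) : Prop :=
  tree T /\ snil ∈ T /\ (forall s, s ∈ T -> Qo (fun n => snoc s n ∈ T)) /\
  forall f, df (fun e _ => f (e O)) -> (forall n, frestr f n ∈ T) ->
    exists n, frestr f n ∈ A.

Definition closed_tree (T : sets M) : Prop :=
  tree T /\ snil ∈ T /\ (forall s, s ∈ T -> Qc (fun n => snoc s n ∈ T)) /\
  forall f, df (fun e _ => f (e O)) -> (forall n, frestr f n ∈ T) ->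
    forall n, ~ frestr f n ∈ A.

(** [s] approximates a function assigning to [(j, u, k)] the answer of the
    avoiding player to the challenge [k] at position [u] when the clock shows
    [j] (or [0] if this position is given up).  The clock runs down the
    Kleene-Brouwer order of the tree [inT], which will be the tree of these
    approximations itself: a coded triple exceeds its component [j], so whether
    [s] belongs to the tree only depends on elements [j < s]. *)
Definition approx (inT : D -> Prop) (s : D) : Prop := isSeq s /\
  forall j u k, pr j (pr u k) < len s ->
    (inT j -> u = snil -> at_ s (pr j (pr u k)) <> 0) /\
    (at_ s (pr j (pr u k)) <> 0 ->
       ~ hit u /\ k + 1 < at_ s (pr j (pr u k))) /\
    (forall n i l, pr i (pr (snoc u n) l) < len s ->
       at_ s (pr j (pr u k)) <> 0 -> inT j -> inT i -> klt i j ->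
       C (at_ s (pr j (pr u k))) n -> at_ s (pr i (pr (snoc u n) l)) <> 0).

Ltac ar_user ::= first
  [apply df_pr|apply df_len|apply df_at|apply df_snoc|apply df_restr
  |apply df_frestr; [assumption|]|apply ar_rlt|apply ar_rle|apply ar_klt|apply ar_hit
  |apply ar_fmem|apply ar_isTriple|apply ar_isFin|apply ar_hasLen|apply ar_isSeq].

Lemma idx_parts s j x : isSeq s -> pr j x < len s -> j < s.
Proof.
  intros Hs H. apply le_lt_trans with (pr j x); [apply pr_gel|now apply idx_lt].
Qed.

(** The clock values that the rules mention lie below [s], so the history can stand for the whole
    tree. Every rule is universal over indices below [len s], whence closure under initial
    segments. *)
Lemma approx_ex : exists T, tree T /\ forall s, s ∈ T <-> approx (fun j => j ∈ T) s.
Proof.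
  destruct (@cov_rec (fun s c => approx (fun j => fmem j c) s)) as [T HT];
    [unfold approx; ars|].
  assert (E : forall s, s ∈ T <-> approx (fun j => j ∈ T) s).
  { intros s. destruct (HT s) as [c [H1 H2]]. rewrite H2. unfold approx.
    split; intros [Hs H]; (split; [exact Hs|]); intros j u k Hj;
      destruct (H j u k Hj) as (A1 & A2 & A3);
      assert (Hj' := idx_parts Hs Hj).
    - split; [|split; [exact A2|]].
      + intros Hj1. apply A1, H1. auto.
      + intros n i l Hi Hv Hj1 Hi1. assert (Hi' := idx_parts Hs Hi).
        apply A3; auto; apply H1; auto.
    - split; [|split; [exact A2|]].
      + intros Hj1. apply A1. now apply H1.
      + intros n i l Hi Hv Hj1 Hi1. apply A3; auto; now apply H1. }
  exists T. split; [|exact E]. intros s Hs. apply E in Hs as [Hs H].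
  split; [exact Hs|]. intros m Hm. apply E.
  destruct (restr_spec s m) as (R1 & R2 & R3). split; [exact R1|].
  rewrite R2. intros j u k Hj.
  assert (Hj' := lt_le_trans Hj Hm). destruct (H j u k Hj') as (A1 & A2 & A3).
  rewrite (R3 _ Hj). split; [exact A1|split; [exact A2|]].
  intros n i l Hi. rewrite (R3 _ Hi). apply A3. eapply lt_le_trans; eauto.
Qed.

(** The path [p] is a strategy for the clock on [T]. At a position of length [i] the clock is set to
    [g i], so each move meets a smaller clock value, as the last rule of [approx] requires. [U]
    consists of the positions that [p] has never given up on the way, whatever the challenge. *)
Lemma closed_tree_ex T g p :
  (forall s, s ∈ T <-> approx (fun j => j ∈ T) s) ->
  df (fun e _ => g (e O)) -> df (fun e _ => p (e O)) ->
  (forall n, g n ∈ T /\ klt (g (n + 1)) (g n)) ->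
  (forall n, frestr p n ∈ T) -> exists U, closed_tree U.
Proof.
  intros HT Hg Hp Hdesc Hpath.
  assert (Hpt : forall j u k, exists s, approx (fun j => j ∈ T) s /\
    pr j (pr u k) < len s /\ forall i, i < len s -> at_ s i = p i).
  { intros j u k. exists (frestr p (pr j (pr u k) + 1)).
    destruct (frestr_spec (pr j (pr u k) + 1) Hp) as (H1 & H2 & H3).
    split; [now apply HT|]. rewrite H2. split; [apply lt_succ|exact H3]. }
  assert (P1 : forall j k, j ∈ T -> p (pr j (pr snil k)) <> 0).
  { intros j k Hj. destruct (Hpt j snil k) as (s & [_ Hs] & L & E).
    destruct (Hs _ _ _ L) as (A1 & _). rewrite (E _ L) in A1. auto. }
  assert (P2 : forall j u k, p (pr j (pr u k)) <> 0 ->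
    ~ hit u /\ k + 1 < p (pr j (pr u k))).
  { intros j u k. destruct (Hpt j u k) as (s & [_ Hs] & L & E).
    destruct (Hs _ _ _ L) as (_ & A2 & _). now rewrite (E _ L) in A2. }
  assert (P3 : forall j u k n i l, p (pr j (pr u k)) <> 0 -> j ∈ T -> i ∈ T ->
    klt i j -> C (p (pr j (pr u k))) n -> p (pr i (pr (snoc u n) l)) <> 0).
  { intros j u k n i l. set (a := pr j (pr u k)). set (b := pr i (pr (snoc u n) l)).
    (* The length [a + b + 1] makes both indices visible to one approximation. *)
    destruct (frestr_spec (a + b + 1) Hp) as (H1 & H2 & H3).
    destruct (proj1 (HT _) (Hpath (a + b + 1))) as [_ Hs].
    assert (La : a < a + b + 1) by (apply lt_ex; exists b; ring).
    assert (Lb : b < a + b + 1) by apply le_addr.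
    rewrite H2 in Hs. destruct (Hs _ _ _ La) as (_ & _ & A3).
    specialize (A3 n i l Lb). unfold a, b in *. now rewrite !H3 in A3. }
  destruct (@comp (fun s => isSeq s /\ forall i, i < len s + 1 ->
    forall k, p (pr (g i) (pr (restr s i) k)) <> 0)) as [U HU]; [ars|].
  exists U. split; [|split; [|split]].
  - intros s Hs. apply HU in Hs as [Hs H]. split; [exact Hs|]. intros m Hm.
    apply HU. destruct (restr_spec s m) as (R1 & R2 & _). split; [exact R1|].
    rewrite R2. intros i Hi k. rewrite restr_restr by exact Hi. apply H.
    apply ltS in Hi as [Hi| ->]; [eapply lt_trans|]; eauto.
  - apply HU. destruct snil_spec as [S1 S2]. split; [exact S1|].
    rewrite S2. intros i Hi k. apply ltS in Hi as [Hi| ->]; [now apply lt0 in Hi|].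
    rewrite restr_0. apply P1, Hdesc.
  - intros s Hs k. apply HU in Hs as [Hs H].
    assert (Hv : forall k, p (pr (g (len s)) (pr s k)) <> 0).
    { intros k'. specialize (H (len s) (lt_succ _) k'). now rewrite restr_len in H. }
    exists (p (pr (g (len s)) (pr s k))). split; [now apply P2|]. intros n Hn.
    apply HU. destruct (snoc_spec s n) as (S1 & S2 & _). split; [exact S1|].
    rewrite S2. intros i Hi l. apply ltS in Hi as [Hi| ->].
    + rewrite restr_snoc by exact Hi. now apply H.
    + rewrite <- S2, restr_len, S2 by exact S1.
      destruct (Hdesc (len s)) as [G1 G2]. destruct (Hdesc (len s + 1)) as [G3 _].
      eapply P3; eauto.
  - intros f Hf H n Hn. destruct (proj1 (HU _) (H n)) as [_ H'].
    destruct (frestr_spec n Hf) as (F1 & F2 & _). rewrite F2 in H'.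
    (* One surviving answer at the position already excludes a hit; challenge 0 is taken. *)
    specialize (H' n (lt_succ n) 0).
    apply P2 in H' as [H' _]. apply H'. rewrite restr_frestr by (auto; apply lt_succ).
    exists n. rewrite F2. split; [apply lt_succ|].
    rewrite restr_frestr by (auto; apply lt_succ). exact Hn.
Qed.

(** [pr u j ∈ Y] says that the position [u] is won for the player who enters
    the open set by stage [j]. *)
Definition ranking (L Y : sets M) : Prop := forall u j, pr u j ∈ Y <->
  rle L j j /\ isSeq u /\
  (hit u \/ Qo (fun n => exists i, rlt L i j /\ pr (snoc u n) i ∈ Y)).

Lemma ranking_ex L : isWO L -> exists Y, ranking L Y.
Proof.
  intros HL.
  destruct (@transfinite_pairs (fun u Z => isSeq u /\
    (hit u \/ Qo (fun n => exists i, pr (snoc u n) i ∈ Z))) L) as [Y HY];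
    [unfold Qo; ars|exact HL|].
  exists Y. intros u j. rewrite HY. destruct (below_ex L Y j) as [Z [HZ HZ']].
  split.
  - intros (Hj & Z' & HB & Hu & H). split; [exact Hj|]. split; [exact Hu|].
    destruct H as [H|H]; [now left|right]. revert H. apply Qo_mono.
    intros n [i Hi]. exists i. apply HZ'. apply HZ. now apply HB in Hi.
  - intros (Hj & Hu & H). split; [exact Hj|]. exists Z. split; [exact HZ|].
    split; [exact Hu|].
    destruct H as [H|H]; [now left|right]. revert H. apply Qo_mono.
    intros n [i Hi]. exists i. now apply HZ'.
Qed.

(** [T] consists of the plays along which the rank drops until the open set is entered; a path that
    never enters it would have stages without a least one. *)
Lemma open_tree_ex L Y j0 : isWO L -> ranking L Y -> pr snil j0 ∈ Y ->
  exists T, open_tree T.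
Proof.
  intros HL HY H0.
  (* Requiring that every stage [j] of the current position be undercut expresses a drop of the
     least stage without introducing a rank function. *)
  destruct (@comp (fun s => isSeq s /\ forall i, i < len s -> hit (restr s i) \/
    forall j, pr (restr s i) j ∈ Y ->
      exists j', rlt L j' j /\ pr (restr s (i + 1)) j' ∈ Y)) as [T HT]; [ars|].
  assert (HTree : tree T).
  { intros s Hs. apply HT in Hs as [Hs H]. split; [exact Hs|]. intros m Hm.
    apply HT. destruct (restr_spec s m) as (R1 & R2 & _). split; [exact R1|].
    rewrite R2. intros i Hi. rewrite (restr_restr s (lt_le Hi)), (restr_restr s (lt_SS _ _ Hi)).
    apply H. eapply lt_le_trans; eauto. }
  assert (HSnoc : forall s n, s ∈ T ->
    (hit s \/ forall j, pr s j ∈ Y -> exists j', rlt L j' j /\ pr (snoc s n) j' ∈ Y) ->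
    snoc s n ∈ T).
  { intros s n Hs Hn. apply HT in Hs as [Hs H]. apply HT.
    destruct (snoc_spec s n) as (S1 & S2 & _). split; [exact S1|]. rewrite S2.
    intros i Hi. rewrite (restr_snoc n Hi). apply ltS in Hi as [Hi| ->].
    - rewrite (restr_snoc n (lt_SS _ _ Hi)). now apply H.
    - rewrite <- S2. now rewrite !restr_len. }
  assert (HNil : snil ∈ T).
  { apply HT. destruct snil_spec as [S1 S2]. split; [exact S1|].
    rewrite S2. intros i Hi. now apply lt0 in Hi. }
  exists T. split; [exact HTree|]. split; [exact HNil|]. split.
  - intros s Hs. destruct (classic (hit s)) as [Hh|Hh].
    (* After a hit every move is acceptable, so it is enough that one exists; an answer above
       [0 + 1] is nonzero. *)
    { exists 0. intros v Hv. destruct (C_total (v := v)) as [n Hn].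
      { intros ->. now apply lt0 in Hv. }
      exists n. split; [exact Hn|]. apply HSnoc; auto. }
    assert (Hr : exists j, pr s j ∈ Y).
    { destruct (proj1 (HT s) Hs) as [Hs1 H].
      assert (B : forall i, i < len s + 1 ->
        hit (restr s i) \/ exists j, pr (restr s i) j ∈ Y).
      { apply (ind (P := fun i => i < len s + 1 ->
          hit (restr s i) \/ exists j, pr (restr s i) j ∈ Y));
          [ars|intros _; right; rewrite restr_0; eauto|]. intros i IH Hi.
        assert (Hi1 := proj1 (succ_le _ _) Hi).
        destruct (IH (lt_le Hi1)) as [B|[j Hj]].
        - exfalso. apply Hh. apply hit_restr with i; [now apply lt_le|exact B].
        - right. destruct (H i Hi1) as [B|B].
          + exfalso. apply Hh. apply hit_restr with i; [now apply lt_le|exact B].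
          + destruct (B j Hj) as (j' & _ & Hj'). eauto. }
      destruct (B (len s) (lt_succ _)) as [B'|B']; rewrite restr_len in B' by exact Hs1;
        [contradiction|exact B']. }
    (* The moves supplied by the ranking at the least stage undercut all stages of [s] at once. *)
    destruct (WO_least (P := fun j => pr s j ∈ Y) HL) as [j [Hj Hmin]]; [ars|exact Hr|].
    destruct (proj1 (HY s j) Hj) as (Lj & Hs1 & [B|B]); [contradiction|].
    revert B. apply Qo_mono. intros n (i & Hi & Hi'). apply HSnoc; [exact Hs|].
    right. intros j' Hj'. exists i. split; [|exact Hi'].
    destruct (proj1 (HY s j') Hj') as [Lj' _].
    assert (Hjj : rle L j j').
    { destruct HL as [(_ & _ & _ & _ & Htot) _].
      destruct (Htot j j' (conj Lj Lj')) as [X|X]; [exact X|].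
      apply NNPP. intros X'. apply (Hmin j'); [now split|exact Hj']. }
    destruct HL as [(_ & _ & Htr & _) _]. destruct Hi as [I1 I2]. split; [eauto|].
    intros X. apply I2. eauto.
  - intros f Hf Hb. apply NNPP. intros N.
    assert (Hh : forall n, ~ hit (frestr f n)).
    { intros n (k & Hk & H). destruct (frestr_spec n Hf) as (_ & E & _).
      rewrite E in Hk. rewrite restr_frestr in H by auto. eauto. }
    (* Minimise over all positions of the path together; the position after the chosen one then has
       a smaller stage. *)
    destruct (WO_least (P := fun j => exists n, pr (frestr f n) j ∈ Y) HL)
      as [j [[n Hj] Hmin]]; [ars|exists j0, 0; now rewrite frestr_0|].
    destruct (proj1 (HT _) (Hb (n + 1))) as [_ H].
    destruct (frestr_spec (n + 1) Hf) as (_ & E & _). rewrite E in H.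
    specialize (H n (lt_succ n)). rewrite restr_frestr in H by (auto using lt_le, lt_succ).
    destruct H as [H|H]; [now apply Hh in H|]. destruct (H j Hj) as (j' & H1 & H2).
    apply (Hmin j' H1). exists (n + 1). rewrite restr_frestr in H2; auto using lt_succ.
Qed.

(** By [Qc_or_Qo], at a position not ranked at [j] each challenge has an answer all of whose moves
    stay unranked at every stage below [j]. Playing the least such answer gives the path. *)
Lemma unranked_path T L Y : (forall s, s ∈ T <-> approx (fun j => j ∈ T) s) ->
  (forall s t, rle L s t <-> s ∈ T /\ t ∈ T /\ (s = t \/ klt s t)) ->
  (forall s t, rlt L s t <-> s ∈ T /\ t ∈ T /\ klt s t) ->
  ranking L Y -> (forall j, ~ pr snil j ∈ Y) ->
  exists f, df (fun e _ => f (e O)) /\ forall n, frestr f n ∈ T.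
Proof.
  intros HT Hle Hlt HY Hnil.
  set (ok := fun i v => exists j u k, i = pr j (pr u k) /\ j ∈ T /\ isSeq u /\
    ~ pr u j ∈ Y /\ k + 1 < v /\
    forall n, C v n -> forall i, rlt L i j -> ~ pr (snoc u n) i ∈ Y).
  assert (Hok : ar (fun e _ => ok (e O) (e 1%nat))) by (unfold ok; ars).
  set (f := fun i => mu (ok i)).
  assert (Hf : df (fun e _ => f (e O))) by (unfold f; apply df_mu; ars).
  (* The default 0 of [mu] is the mark of a position given up; genuine answers exceed [k + 1] and so
     never collide with it. *)
  assert (F1 : forall i, f i <> 0 -> ok i (f i)).
  { intros i Hi. apply (mu_spec (P := ok i)); [ars|]. apply NNPP. intros N.
    apply Hi. destruct (@comp (ok i)) as [X HX]; [ars|].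
    destruct (mu_ex HX) as [[H _]|[_ H]]; [|exact H]. destruct N. eauto. }
  assert (F2 : forall j u k, j ∈ T -> isSeq u -> ~ pr u j ∈ Y ->
    f (pr j (pr u k)) <> 0).
  { intros j u k Hj Hu Hr.
    assert (H : exists v, ok (pr j (pr u k)) v).
    { destruct (Qc_or_Qo (fun n => forall i, rlt L i j -> ~ pr (snoc u n) i ∈ Y))
        as [H|H].
      - destruct (H k) as (v & Hv & Hv'). exists v, j, u, k. auto 7.
      - exfalso. apply Hr. apply HY. split; [apply Hle; auto|]. split; [exact Hu|].
        right. revert H. apply Qo_mono. intros n Hn. apply NNPP. intros N.
        apply Hn. intros i Hi Hi'. eauto. }
    apply (mu_spec (P := ok (pr j (pr u k)))) in H; [|ars].
    fold (f (pr j (pr u k))) in H. intros E. rewrite E in H.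
    destruct H as (_ & _ & k' & _ & _ & _ & _ & H & _). now apply lt0 in H. }
  assert (F3 : forall j u k, f (pr j (pr u k)) <> 0 -> j ∈ T /\ isSeq u /\
    ~ pr u j ∈ Y /\ k + 1 < f (pr j (pr u k)) /\
    forall n, C (f (pr j (pr u k))) n -> forall i, rlt L i j -> ~ pr (snoc u n) i ∈ Y).
  { intros j u k H. apply F1 in H as (j' & u' & k' & E & H).
    apply pr_inj in E as [<- E]. now apply pr_inj in E as [<- <-]. }
  exists f. split; [exact Hf|]. intros m. apply HT.
  destruct (frestr_spec m Hf) as (R1 & R2 & R3). split; [exact R1|]. rewrite R2.
  intros j u k Hj. rewrite (R3 _ Hj). split; [|split].
  - intros HjT ->. apply F2; [exact HjT|apply snil_spec|apply Hnil].
  - intros H. apply F3 in H as (H1 & H2 & H3 & H4 & _). split; [|exact H4].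
    intros Hh. apply H3, HY. split; [apply Hle; auto|]. auto.
  - intros n i l Hi Hv HjT HiT Hij Hn. rewrite (R3 _ Hi).
    apply F3 in Hv as (_ & _ & _ & _ & H). apply F2; [exact HiT|apply snoc_spec|].
    apply (H n Hn). apply Hlt. auto.
Qed.

Theorem game_dichotomy : (exists T, open_tree T) \/ (exists T, closed_tree T).
Proof.
  destruct approx_ex as (T & HTree & HT).
  destruct (@KB_ex T) as (L & HLO & Hle & Hlt); [intros s Hs; now apply HTree|].
  destruct (classic (isWO L)) as [HL|HL].
  - left. destruct (ranking_ex HL) as [Y HY].
    destruct (classic (exists j, pr snil j ∈ Y)) as [[j Hj]|H].
    + exact (open_tree_ex HL HY Hj).
    + exfalso.
      destruct (unranked_path HT Hle Hlt HY) as (f & Hf & Hp); [eauto|].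
      apply (WO_no_descent (g := frestr f) HL); [ars|].
      intros n. apply Hlt. split; [apply Hp|]. split; [apply Hp|].
      destruct (frestr_spec n Hf) as (_ & E1 & A1).
      destruct (frestr_spec (n + 1) Hf) as (_ & E2 & A2).
      exists n. rewrite E1, E2. split; [apply lt_succ|]. split; [|now right].
      intros i Hi. rewrite A1, A2; auto using lt_le.
  - right. destruct (not_WO_descent HLO HL) as (g & Hg & Hdesc).
    assert (Hd : forall n, g n ∈ T /\ klt (g (n + 1)) (g n)).
    { intros n. now destruct (proj1 (Hlt _ _) (Hdesc n)) as (_ & H1 & H2). }
    destruct (descent_path HTree Hg Hd) as (p & Hp & Hpath).
    exact (closed_tree_ex HT Hg Hp Hd Hpath).
Qed.

End Game.

(** * Hechler and Laver trees *)

Definition isNil (s : D) : Prop := isSeq s /\ forall x, ~ fmem x s.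

Definition isPrefix (s t : D) : Prop :=
  isSeq s /\ isSeq t /\ forall x, fmem x s -> fmem x t.

Definition isSnoc (s n t : D) : Prop := isSeq s /\ isSeq t /\
  exists l, hasLen s l /\ forall x, fmem x t <-> fmem x s \/ x = pr l n.

Definition isRestr (F : sets M) (n s : D) : Prop :=
  isSeq s /\ hasLen s n /\ forall x, fmem x s -> x ∈ F.

Definition seqSet (A : sets M) : Prop := forall s, s ∈ A -> isSeq s.

Definition isTree (T : sets M) : Prop :=
  seqSet T /\ forall s t, t ∈ T /\ isPrefix s t -> s ∈ T.

Definition snocMem (s n : D) (T : sets M) : Prop := exists t, isSnoc s n t /\ t ∈ T.

Definition isLaver (T : sets M) : Prop := isTree T
  /\ (exists s, isNil s /\ s ∈ T)
  /\ (forall s, s ∈ T -> forall k, exists n, k < n /\ snocMem s n T).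

Definition isHechler (T : sets M) : Prop := isLaver T
  /\ (forall s, s ∈ T -> exists k, forall n, k < n -> snocMem s n T).

Definition inBody (F T : sets M) : Prop :=
  isFun F /\ forall n, exists s, isRestr F n s /\ s ∈ T.

Definition inOpen (F A : sets M) : Prop :=
  isFun F /\ exists n s, isRestr F n s /\ s ∈ A.

Lemma sat_HL_Sigma01 e v : sat M e v HL_Sigma01 <-> forall A, seqSet A ->
  (exists T, isHechler T /\ forall F, inBody F T -> inOpen F A) \/
  (exists T, isLaver T /\ forall F, inBody F T -> ~ inOpen F A).
Proof. rewrite <- nsat_sat. reflexivity. Qed.

Lemma sat_HL_Pi01 e v : sat M e v HL_Pi01 <-> forall A, seqSet A ->
  (exists T, isHechler T /\ forall F, inBody F T -> ~ inOpen F A) \/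
  (exists T, isLaver T /\ forall F, inBody F T -> inOpen F A).
Proof. rewrite <- nsat_sat. reflexivity. Qed.

Lemma isPrefix_restr s t : isPrefix s t -> len s < len t + 1 /\ s = restr t (len s).
Proof.
  intros (Hs & Ht & H).
  assert (B : forall i, i < len s -> i < len t /\ at_ s i = at_ t i).
  { intros i Hi. apply seq_at; [exact Ht|]. apply H. now apply seq_at. }
  split.
  - destruct (lt_total (len s) (len t)) as [L|[L|L]].
    + now apply lt_le.
    + rewrite L. apply lt_succ.
    + destruct (B _ L) as [L' _]. now apply lt_irrefl in L'.
  - symmetry. apply restr_eq; auto. intros i Hi. now apply B.
Qed.

Lemma isSnoc_snoc s n : isSeq s -> isSnoc s n (snoc s n).
Proof.
  intros Hs. destruct (snoc_spec s n) as (H1 & H2 & H3 & H4).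
  split; [exact Hs|]. split; [exact H1|]. exists (len s).
  split; [now apply seq_len|]. intros x. rewrite !seq_mem, H2 by assumption. split.
  - intros (i & Hi & ->). apply ltS in Hi as [Hi| ->].
    + left. exists i. split; [exact Hi|]. now rewrite H4.
    + right. now rewrite H3.
  - intros [(i & Hi & ->)| ->].
    + exists i. split; [now apply lt_le|]. now rewrite H4.
    + exists (len s). split; [apply lt_succ|]. now rewrite H3.
Qed.

Lemma isRestr_iff F f n s : df (fun e _ => f (e O)) ->
  (forall x y, pr x y ∈ F <-> y = f x) -> isRestr F n s <-> s = frestr f n.
Proof.
  intros Hf HF. destruct (frestr_spec n Hf) as (H1 & H2 & H3). split.
  - intros (Hs & Hl & H). apply len_eq in Hl; [|exact Hs]. symmetry.
    apply frestr_eq; auto. intros i Hi. apply HF, H, seq_at; [exact Hs|].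
    now rewrite Hl.
  - intros ->. split; [exact H1|]. split.
    + assert (L := seq_len H1). now rewrite H2 in L.
    + intros x Hx. apply seq_mem in Hx as (i & Hi & ->); [|exact H1].
      apply HF, H3. now rewrite <- H2.
Qed.

Lemma tree_isTree T : tree T -> isTree T.
Proof.
  intros H. split; [intros s Hs; now apply H|]. intros s t [Ht Hp].
  apply isPrefix_restr in Hp as [H1 ->]. now apply H.
Qed.

Lemma snil_isNil : isNil snil.
Proof.
  destruct snil_spec as [H1 H2]. split; [exact H1|]. intros x Hx.
  apply seq_mem in Hx as (i & Hi & _); [|exact H1]. rewrite H2 in Hi.
  now apply lt0 in Hi.
Qed.

Definition infinitely_many (P : D -> Prop) := forall k, exists n, k < n /\ P n.
Definition almost_all (P : D -> Prop) := exists k, forall n, k < n -> P n.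

Lemma almost_all_infinitely_many P : almost_all P -> infinitely_many P.
Proof.
  intros [b Hb] k. exists (b + k + 1). split; [apply le_addr|]. apply Hb.
  apply lt_ex. now exists k.
Qed.

Lemma Laver_intro T : tree T -> snil ∈ T ->
  (forall s, s ∈ T -> infinitely_many (fun n => snoc s n ∈ T)) -> isLaver T.
Proof.
  intros H1 H2 H3. split; [now apply tree_isTree|]. split.
  - exists snil. split; [apply snil_isNil|exact H2].
  - intros s Hs k. destruct (H3 s Hs k) as (n & Hn & Hs'). exists n.
    split; [exact Hn|]. exists (snoc s n). split; [|exact Hs'].
    apply isSnoc_snoc. now apply H1.
Qed.

Lemma Hechler_intro T : tree T -> snil ∈ T ->
  (forall s, s ∈ T -> almost_all (fun n => snoc s n ∈ T)) -> isHechler T.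
Proof.
  intros H1 H2 H3. split.
  - apply Laver_intro; auto using almost_all_infinitely_many.
  - intros s Hs. destruct (H3 s Hs) as [k Hk]. exists k. intros n Hn.
    exists (snoc s n). split; [|auto]. apply isSnoc_snoc. now apply H1.
Qed.

Lemma open_tree_body A C T F : open_tree A C T -> inBody F T -> inOpen F A.
Proof.
  intros (_ & _ & _ & H) [HF HB]. split; [exact HF|].
  destruct (fun_of_graph HF) as (f & Hf & E).
  destruct (H f Hf) as [n Hn].
  - intros n. destruct (HB n) as (s & Hs & HsT).
    now apply (isRestr_iff n s Hf E) in Hs as ->.
  - exists n, (frestr f n). split; [|exact Hn]. now apply (isRestr_iff n _ Hf E).
Qed.

Lemma closed_tree_body A C T F : closed_tree A C T -> inBody F T -> ~ inOpen F A.
Proof.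
  intros (_ & _ & _ & H) [HF HB] (_ & n & s & Hs & HsA).
  destruct (fun_of_graph HF) as (f & Hf & E).
  apply (isRestr_iff n s Hf E) in Hs as ->. revert HsA. apply (H f Hf).
  intros m. destruct (HB m) as (s & Hs & HsT).
  now apply (isRestr_iff m s Hf E) in Hs as ->.
Qed.

Lemma model_HL_Sigma01 e v : sat M e v HL_Sigma01.
Proof.
  apply sat_HL_Sigma01. intros A _.
  (* The answer is the move itself, raised by one to keep 0 free, and [k + 1 < v] then says [k < n].
     So [Qc] means infinitely many and [Qo] all but finitely many. *)
  destruct (@game_dichotomy A (fun v n => v = n + 1)) as [[T HT]|[T HT]].
  - ars.
  - intros w Hw. destruct (case0S w) as [->|[n ->]]; [contradiction|eauto].
  - left. exists T. split; [|intros F; apply (open_tree_body HT)].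
    destruct HT as (H1 & H2 & H3 & _). apply Hechler_intro; auto. intros s Hs.
    destruct (H3 s Hs) as [k Hk]. exists k. intros n Hn.
    destruct (Hk (n + 1)) as (n' & E & Hn'); [now apply lt_SS|].
    apply succ_inj in E. now subst n'.
  - right. exists T. split; [|intros F; apply (closed_tree_body HT)].
    destruct HT as (H1 & H2 & H3 & _). apply Laver_intro; auto. intros s Hs k.
    destruct (H3 s Hs k) as (w & Hw & Hw').
    destruct (case0S w) as [->|[n ->]]; [now apply lt0 in Hw|].
    exists n. split; [now apply succ_le|auto].
Qed.

Lemma model_HL_Pi01 e v : sat M e v HL_Pi01.
Proof.
  apply sat_HL_Pi01. intros A _.
  (* Now the answer is a lower bound for the move, so [Qc] means all but finitely many and [Qo]
     infinitely many; the tree of the avoider becomes the Hechler tree. *)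
  destruct (@game_dichotomy A (fun v n => v < n + 1)) as [[T HT]|[T HT]].
  - ars.
  - intros w _. exists w. apply lt_succ.
  - right. exists T. split; [|intros F; apply (open_tree_body HT)].
    destruct HT as (H1 & H2 & H3 & _). apply Laver_intro; auto. intros s Hs k.
    destruct (H3 s Hs) as [b Hb].
    (* This answer exceeds [b + 1], as [Hb] requires, and pushes the move beyond [k]. *)
    destruct (Hb (b + k + 1 + 1)) as (n & Hn & Hn').
    + apply lt_SS. apply lt_ex. now exists k.
    + exists n. split; [|exact Hn']. eapply lt_trans; [|apply succ_le; exact Hn].
      apply le_addr.
  - left. exists T. split; [|intros F; apply (closed_tree_body HT)].
    destruct HT as (H1 & H2 & H3 & _). apply Hechler_intro; auto. intros s Hs.
    destruct (H3 s Hs 0) as (w & _ & Hw). exists w. intros n Hn.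
    apply Hw. now apply lt_le.
Qed.

End Model.

Theorem theorem1p5 : proves ATR0 HL_Sigma01 /\ proves ATR0 HL_Pi01.
Proof.
  split; apply completeness.
  (* Being a sentence is checked by computation: each variable is caught by its binder, where
     substitution acts as the identity. *)
  - reflexivity.
  - intros M HM e v. exact (@model_HL_Sigma01 M HM v e v).
  - reflexivity.
  - intros M HM e v. exact (@model_HL_Pi01 M HM v e v).
Qed.
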